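(* Let $(X,\mathcal E)$ and $(Y,\mathcal F)$ be uniformly locally finite coarse spaces. If $(X,\mathcal E)$ is metrizable, $\Phi\colon\mathrm{C}^*_u(X)\to\mathrm{C}^*_u(Y)$ is an embedding, and at least one of the following conditions applies: (1) $(Y,\mathcal F)$ is metrizable and $\Phi(\ell_\infty(X))$ is a co-separable Cartan masa of $\mathrm{C}^*_u(Y)$, or (2) $\ell_\infty(Y)\subseteq\Phi(\mathrm{C}^*_u(X))$, then there is a coarse and uniformly finite-to-one map $f\colon X\to Y$ such that $$\inf_{x\in X}\|\Phi(\chi_x)\delta_{f(x)}\|>0.$$
   Context: A coarse space is a set $X$ with a family $\mathcal E$ of subsets of $X\times X$ (entourages) that contains the diagonal $\Delta_X$ and is closed under subsets, finite unions, inverses $E^{-1}=\{(y,x):(x,y)\in E\}$ and compositions $E\circ F=\{(x,y):\exists z,\ (x,z)\in E,\ (z,y)\in F\}$. It is uniformly locally finite if $\sup_{x\in X}|\{z\in X:(x,z)\in E\}|<\infty$ for all $E\in\mathcal E$. It is metrizable if $\mathcal E=\{E\subseteq X\times X:\sup_{(x,y)\in E}d(x,y)<\infty\}$ for some metric $d$ on $X$. A map $f\colon X\to Y$ is coarse if for all $E\in\mathcal E$ there is $F\in\mathcal F$ such that $(x,z)\in E$ implies $(f(x),f(z))\in F$; it is uniformly finite-to-one if there is a uniform finite bound on the cardinalities of preimages of points in its range. $(\delta_x)_{x\in X}$ is the canonical basis of $\ell_2(X)$; $\chi_x$ is the orthogonal projection onto $\mathbb C\delta_x$. For $a\in\mathcal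 B(\ell_2(X))$, $\mathrm{supp}(a)=\{(x,z):\langle a\delta_z,\delta_x\rangle\neq0\}$. The uniform Roe algebra $\mathrm{C}^*_u(X)$ is the norm closure of $\{a\in\mathcal B(\ell_2(X)):\mathrm{supp}(a)\in\mathcal E\}$. $\ell_\infty(X)\subseteq\mathrm{C}^*_u(X)$ is identified with the operators diagonal with respect to the canonical basis. An embedding is an injective $*$-homomorphism. Let $A$ be a unital $\mathrm{C}^*$-algebra. A $\mathrm{C}^*$-subalgebra $B\subseteq A$ is a Cartan masa in $A$ if: (i) $B$ is a maximal abelian self-adjoint subalgebra (masa) of $A$; (ii) $A$ is generated as a $\mathrm{C}^*$-algebra by the normalizer $N_A(B)=\{a\in A\mid aBa^*\cup a^*Ba\subseteq B\}$; (iii) there is a faithful conditional expectation $\Upsilon\colon A\to B$, i.e. a completely positive map with $\Upsilon(b)=b$ for $b\in B$, $\Upsilon(b_1ab_2)=b_1\Upsilon(a)b_2$ for $a\in A$, $b_1,b_2\in B$, and such that $\Upsilon(a^*a)=0$ implies $a=0$. A Cartan masa $B\subseteq\mathrm{C}^*_u(Y)$ is co-separable if there is a countable $S\subseteq\mathrm{C}^*_u(Y)$ such that $\mathrm{C}^*_u(Y)$ is the $\mathrm{C}^*$-algebra generated by $B\cup S$. *)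

(* Defs.v *)
From HB Require Import structures.
From mathcomp Require Import all_boot all_order all_algebra.
From mathcomp Require Import all_classical all_reals all_analysis.
From mathcomp Require Import complex ring.
From mathcomp.analysis.showcase Require summability.

Set Implicit Arguments.
Unset Strict Implicit.
Unset Printing Implicit Defensive.

Import Order.TTheory GRing.Theory Num.Theory numFieldNormedType.Exports.

Local Open Scope classical_set_scope.
Local Open Scope card_scope.
Local Open Scope ring_scope.

Section CoarseSpaces.
Variables (X Y : Type).
Implicit Types (E : set (set (X * X))) (F : set (set (Y * Y))).

(* [V \; U] is the library's notation for
   [set p | exists2 z, U (p.1, z) & V (z, p.2)]. *)
Record coarse_structure E : Prop := CoarseStructure {
  coarse_diagonal : E diagonal ;
  coarse_subset : forall U V, U `<=` V -> E V -> E U ;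
  coarse_setU : forall U V, E U -> E V -> E (U `|` V) ;
  coarse_inverse : forall U, E U -> E (U^-1)%relation ;
  coarse_comp : forall U V, E U -> E V -> E (V \; U)%relation }.

Definition uniformly_locally_finite E : Prop :=
  forall U, E U -> exists n : nat, forall x, [set z | U (x, z)] #<= `I_n.

Definition is_metric (R : realType) (d : X -> X -> R) : Prop :=
  [/\ forall x y, 0 <= d x y,
      forall x y, d x y = 0 <-> x = y,
      forall x y, d x y = d y x
    & forall x y z, d x z <= d x y + d y z].

Definition metrizable (R : realType) E : Prop :=
  exists2 d : X -> X -> R, is_metric d
    & E = [set U | (ereal_sup [set (d p.1 p.2)%:E | p in U] < +oo)%E].

Definition coarse_map E F (f : X -> Y) : Prop :=
  forall U, E U -> exists2 V, F V & forall x z, U (x, z) -> V (f x, f z).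

Definition uniformly_finite_to_one (f : X -> Y) : Prop :=
  exists n : nat, forall y, range f y -> f @^-1` [set y] #<= `I_n.

End CoarseSpaces.

(* The norm of [R[i]] provided by the library takes its values in [R[i]]. *)
Definition absC (R : realType) (z : R[i]) : R := complex.Re `|z|.

Section Ell2.
Variables (R : realType) (X : choiceType).

Definition square_summable : {pred X -> R[i]} :=
  [pred u | `[< (\esum_(x in [set: X]) (absC (u x) ^+ 2)%:E < +oo)%E >]].

Let absC_ge0 (z : R[i]) : 0 <= absC z.
Proof. by have := normr_ge0 z; rewrite lecE => /andP[]. Qed.

Let absCM (z w : R[i]) : absC (z * w) = absC z * absC w.
Proof. by rewrite /absC normrM !normc_def /= mulr0 subr0. Qed.

Let ler_absCD (z w : R[i]) : absC (z + w) <= absC z + absC w.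
Proof. by have := ler_normD z w; rewrite lecE => /andP[_]; rewrite raddfD. Qed.

Let ler_absCD2 (a z w : R[i]) :
  absC (a * z + w) ^+ 2 <= (2 * absC a ^+ 2) * absC z ^+ 2 + 2 * absC w ^+ 2.
Proof.
have := ler_absCD (a * z) w; rewrite absCM => h.
apply: (@le_trans _ _ ((absC a * absC z + absC w) ^+ 2)).
  by rewrite ler_sqr ?nnegrE// ?addr_ge0 ?mulr_ge0.
set p := absC a * absC z; set q := absC w.
have -> : 2 * absC a ^+ 2 * absC z ^+ 2 + 2 * q ^+ 2
   = (p + q) ^+ 2 + (p - q) ^+ 2 by rewrite /p; ring.
by rewrite lerDl sqr_ge0.
Qed.

Let esum_scale_lty (c : R) (f : X -> R) : 0 <= c -> (forall x, 0 <= f x) ->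
  (\esum_(x in [set: X]) (f x)%:E < +oo ->
   \esum_(x in [set: X]) (c * f x)%:E < +oo)%E.
Proof.
move=> c0 f0 fty.
apply: (@le_lt_trans _ _ (c%:E * \esum_(x in [set: X]) (f x)%:E)%E); last first.
  by rewrite lte_mul_pinfty.
apply: ge_ereal_sup => _ [A [finA _] <-].
under eq_fsbigr do rewrite EFinM.
rewrite -ge0_mule_fsumr; last by move=> x; rewrite lee_fin.
apply: lee_wpmul2l; first by rewrite lee_fin.
by apply: ereal_sup_ubound; exists A.
Qed.

Let square_summable_submod : GRing.submod_closed square_summable.
Proof.
split=> [|a u v].
  apply/asboolP; rewrite esum1 ?ltry// => x _.
  by rewrite /absC normr0 expr0n.
move=> /asboolP su /asboolP sv; apply/asboolP.
apply: (@le_lt_trans _ _ (\esum_(x in [set: X])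
   ((2 * absC a ^+ 2 * absC (u x) ^+ 2)%:E + (2 * absC (v x) ^+ 2)%:E))%E).
  by apply: le_esum => x _; rewrite -EFinD lee_fin; exact: ler_absCD2.
rewrite esumD; last 2 first.
- by move=> x _; rewrite lee_fin !mulr_ge0// sqr_ge0.
- by move=> x _; rewrite lee_fin !mulr_ge0// sqr_ge0.
by apply: lte_add_pinfty; apply: esum_scale_lty => // *;
  rewrite ?mulr_ge0// sqr_ge0.
Qed.

HB.instance Definition _ :=
  GRing.isSubmodClosed.Build R[i] (X -> R[i]) square_summable
    square_summable_submod.

Record ell2 := Ell2 {
  ell2_fun :> X -> R[i] ;
  ell2P : ell2_fun \in square_summable }.

HB.instance Definition _ := [isSub for ell2_fun].
HB.instance Definition _ := [Choice of ell2 by <:].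
HB.instance Definition _ := [SubChoice_isSubLmodule of ell2 by <:].

Definition l2norm (u : ell2) : R :=
  Num.sqrt (fine (\esum_(x in [set: X]) (absC (u x) ^+ 2)%:E)%E).

(* [summability.sum] is the limit of the finite partial sums along the
   directed set of finite subsets of [X]. *)
Definition inner (u v : ell2) : R[i] :=
  summability.sum (fun x => (u x * (v x)^* : R[i]^o)).

Let delta_subproof (x : X) :
  (fun z => (z == x)%:R : R[i]) \in square_summable.
Proof.
apply/asboolP; rewrite (esumID [set x])//; last first.
  by move=> z _; rewrite lee_fin sqr_ge0.
rewrite setTI esum_set1 ?lee_fin ?sqr_ge0// esum1 ?adde0 ?ltry//.
by move=> z [_ /eqP/negPf ->]; rewrite /absC normr0 expr0n.
Qed.

Definition delta (x : X) : ell2 := Ell2 (delta_subproof x).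

End Ell2.

Notation operator R X := (ell2 R X -> ell2 R X).

Section Operators.
Variables (R : realType) (X : choiceType).
Local Notation op := (operator R X).

Definition bounded_op : set op :=
  [set a | linear a /\ exists M : R, forall u, l2norm (a u) <= M * l2norm u].

Definition opnorm (a : op) : R :=
  sup [set l2norm (a u) | u in [set u : ell2 R X | l2norm u <= 1]].

(* There is exactly one such operator when [a] is bounded. *)
Definition adj (a : op) : op :=
  xget 0 [set b | bounded_op b /\ forall u v, inner (a u) v = inner u (b v)].

(* [chi x] is the orthogonal projection onto the line spanned by [delta x]. *)
Definition chi (x : X) : op := fun u => inner u (delta R x) *: delta R x.

Definition supp (a : op) : set (X * X) :=
  [set p | inner (a (delta R p.2)) (delta R p.1) != 0].

Definition norm_closure (S : set op) : set op :=
  [set a | bounded_op a /\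
    forall e : R, 0 < e -> exists2 b, S b & opnorm (a - b) < e].

Definition uniform_Roe (E : set (set (X * X))) : set op :=
  norm_closure [set a | bounded_op a /\ E (supp a)].

(* The copy of l_infty(X) in B(l_2(X)): the diagonal bounded operators. *)
Definition ell_infty : set op :=
  [set a | bounded_op a /\ supp a `<=` diagonal].

Definition star_subalgebra (A : set op) : Prop :=
  [/\ A `<=` bounded_op,
      A 0,
      forall (c : R[i]) a b, A a -> A b -> A (c *: a + b),
      forall a b, A a -> A b -> A (a \o b)
    & forall a, A a -> A (adj a)].

Definition cstar_algebra (A : set op) : Prop :=
  star_subalgebra A /\ norm_closure A `<=` A.

Definition cstar_generated (S : set op) : set op := smallest cstar_algebra S.

Definition abelian_star_subalgebra (A B : set op) : Prop :=
  [/\ star_subalgebra B, B `<=` A & forall a b, B a -> B b -> a \o b = b \o a].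

Definition masa (A B : set op) : Prop :=
  abelian_star_subalgebra A B /\
  forall D, abelian_star_subalgebra A D -> B `<=` D -> D `<=` B.

Definition normalizer (A B : set op) : set op :=
  [set a | A a /\
    forall b, B b -> B (a \o b \o adj a) /\ B (adj a \o b \o a)].

(* The positive elements [c^* c] of the matrix algebra M_n(A). *)
Definition mx_positive (A : set op) (n : nat) : set 'M[op]_n :=
  [set m | exists2 c : 'M[op]_n, forall i j, A (c i j)
    & m = \matrix_(i, j) \sum_(k < n) (adj (c k i) \o c k j)].

Definition completely_positive (A B : set op) (Ups : op -> op) : Prop :=
  [/\ forall a, A a -> B (Ups a),
      forall (c : R[i]) a b, A a -> A b -> Ups (c *: a + b) = c *: Ups a + Ups b
    & forall n (m : 'M[op]_n), mx_positive A m -> mx_positive B (map_mx Ups m)].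

Definition faithful_conditional_expectation (A B : set op) (Ups : op -> op) :
  Prop :=
  [/\ completely_positive A B Ups,
      forall b, B b -> Ups b = b,
      forall a b1 b2, A a -> B b1 -> B b2 ->
        Ups (b1 \o a \o b2) = b1 \o Ups a \o b2
    & forall a, A a -> Ups (adj a \o a) = 0 -> a = 0].

Definition cartan_masa (A B : set op) : Prop :=
  [/\ cstar_algebra B /\ B `<=` A,
      masa A B,
      A = cstar_generated (normalizer A B)
    & exists Ups, faithful_conditional_expectation A B Ups].

Definition co_separable (A B : set op) : Prop :=
  exists S : set op,
    [/\ countable S, S `<=` A & A = cstar_generated (B `|` S)].

End Operators.

(* Maps between operator algebras are maps between the ambient spaces of
   functions; only their values on the algebra in question matter. *)
Definition embedding (R : realType) (X Y : choiceType)
    (A : set (operator R X)) (B : set (operator R Y))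
    (Phi : operator R X -> operator R Y) : Prop :=
  [/\ forall a, A a -> B (Phi a),
      forall (c : R[i]) a b, A a -> A b -> Phi (c *: a + b) = c *: Phi a + Phi b,
      forall a b, A a -> A b -> Phi (a \o b) = Phi a \o Phi b,
      forall a, A a -> Phi (adj a) = adj (Phi a)
    & forall a b, A a -> A b -> Phi a = Phi b -> a = b].

(* Main.v *)
(* Each projection Phi(chi_x) has rank one, say with range spanned by the unit
   vector xi_x.  In both cases there are relations T_0 <= T_1 <= ... on X, with
   uniformly finite rows and columns, such that for every subset A of Y and
   every eta > 0 some T_n satisfies: for all x, chi_A xi_x is eta-close to the
   span of the xi_w with (x, w) in T_n.  When l_infty(Y) lies in the range of
   Phi, T_n = {d <= n}; in the Cartan case, the xi_x form an orthonormal basis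
   in which the normalizers are monomial matrices, and the T_n come from
   approximating a countable set of generators by combinations of normalizers.
   A gliding hump makes n uniform over all finite A.

   Lower bound: if all coordinates of xi_x were small, suitable signs t would
   make the projection of t xi_x to the uniformly finite-dimensional span
   above small, although t xi_x is eta-close to that span.  This gives f with
   |xi_x(f(x))| >= d > 0, and f is finite-to-one by Bessel's inequality.

   Coarseness: applied to singletons A, uniformity puts delta_{f(x)} close to
   the span of the xi_w with (x, w) in T_n.  An entourage is a finite union of
   T_n-separated partial bijections, each giving a partial isometry v; then the
   (f(x), f(z)) entry of Phi(v) is close to its x-z term, hence bounded below,
   and any close enough operator of controlled support is nonzero there. *)
Require Import Defs.
From mathcomp Require Import all_boot all_order all_algebra.
From mathcomp Require Import all_classical all_reals all_analysis.
From mathcomp Require Import finmap complex ring lra.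
From mathcomp.analysis.showcase Require summability.

Set Implicit Arguments.
Unset Strict Implicit.
Unset Printing Implicit Defensive.

Import Order.TTheory GRing.Theory Num.Theory numFieldNormedType.Exports.

Local Open Scope classical_set_scope.
Local Open Scope card_scope.
Local Open Scope ring_scope.

(** * The modulus and unordered sums *)

Section Modulus.
Variable R : realType.
Implicit Types z w : R[i].

Lemma absCE z : `|z| = (absC z)%:C%C.
Proof. by rewrite /absC normc_def. Qed.

Lemma absC_ge0 z : 0 <= absC z.
Proof. by have := normr_ge0 z; rewrite absCE lecR. Qed.

Lemma absCM z w : absC (z * w) = absC z * absC w.
Proof. by rewrite /absC normrM !normc_def /= mulr0 subr0. Qed.

Lemma ler_absCD z w : absC (z + w) <= absC z + absC w.
Proof. by have := ler_normD z w; rewrite !absCE -raddfD lecR. Qed.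

Lemma absCN z : absC (- z) = absC z.
Proof. by rewrite /absC normrN. Qed.

Lemma absC_conj z : absC z^* = absC z.
Proof. by rewrite /absC norm_conjC. Qed.

Lemma absC0 : absC (0 : R[i]) = 0.
Proof. by rewrite /absC normr0. Qed.

Lemma absC1 : absC (1 : R[i]) = 1.
Proof. by rewrite /absC normr1. Qed.

Lemma absC_eq0 z : (absC z == 0) = (z == 0).
Proof. by rewrite -(normr_eq0 z) absCE -(inj_eq (@complexI R)). Qed.

Lemma absC_real (r : R) : absC r%:C%C = `|r|.
Proof. by rewrite /absC normc_def /= expr0n addr0 sqrtr_sqr. Qed.

Lemma mul_conjC z : z * z^* = (absC z ^+ 2)%:C%C.
Proof. by rewrite -normCK absCE rmorphXn. Qed.

Lemma conjC_real_complex (r : R) : (r%:C%C)^* = r%:C%C :> R[i].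
Proof. exact: conjc_real. Qed.

End Modulus.

Section Sums.
Variables (R : realType) (X : choiceType).
Implicit Types f g : X -> R[i].

(** Convergence along the directed set of finite subsets, the limit behind [summability.sum],
    written with a real tolerance so that estimates can use [absC]. *)
Definition has_sum f (l : R[i]) := forall e : R, 0 < e ->
  exists A : {fset X}, forall B : {fset X}, (A `<=` B)%fset ->
    absC (\sum_(x <- B) f x - l) < e.

Lemma has_sum_sum f l : has_sum f l -> summability.sum (f : X -> R[i]^o) = l.
Proof.
have ? := @summability.totally_filter X.
move=> fl; apply: cvg_lim; first exact: norm_hausdorff.
apply/cvgrPdist_lt => eps eps0.
(* The tolerance supplied by the topology is a positive element of [R[i]]; the order there forces
   its imaginary part to vanish. *)
have epsE : eps = (complex.Re eps)%:C%C.
  by move: eps0; rewrite ltcE /= => /andP[/eqP]; case: eps => a b /= ->.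
have e0 : 0 < complex.Re eps by move: eps0; rewrite epsE ltcR.
have [A AP] := fl _ e0.
exists A => // B /= AB.
rewrite distrC absCE epsE ltcR /summability.partial_sum.
rewrite (_ : \sum_(i : B) f (val i) = \sum_(x <- B) f x); first exact: AP.
by rewrite [RHS]big_seq_fsetE.
Qed.

Lemma has_sum_lin f g a l m : has_sum f l -> has_sum g m ->
  has_sum (fun x => a * f x + g x) (a * l + m).
Proof.
move=> fl gm e e0.
have a1 : 0 < absC a + 1 by rewrite ltr_pwDr ?absC_ge0.
have [A AP] := fl (e / 2 / (absC a + 1)) (divr_gt0 (divr_gt0 e0 (ltr0n _ 2)) a1).
have [B BP] := gm (e / 2) (divr_gt0 e0 (ltr0n _ 2)).
exists (A `|` B)%fset => C; rewrite fsubUset => /andP[AC BC].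
rewrite big_split/= -mulr_sumr.
set s := \sum_(_ <- _) _; set t := \sum_(_ <- _) _.
have -> : a * s + t - (a * l + m) = a * (s - l) + (t - m) by ring.
apply: le_lt_trans (ler_absCD _ _) _; rewrite absCM [e]splitr.
apply: ler_ltD; last exact: BP.
have := AP _ AC; rewrite -/s ltr_pdivlMr// => /ltW.
apply: le_trans; rewrite mulrC ler_wpM2l ?absC_ge0// lerDl//.
Qed.

Lemma has_sum_unique f l m : has_sum f l -> has_sum f m -> l = m.
Proof. by move=> /has_sum_sum <- /has_sum_sum <-. Qed.

Lemma has_sum_conj f l : has_sum f l -> has_sum (fun x => (f x)^*) l^*.
Proof.
move=> fl e e0; have [A AP] := fl e e0; exists A => B AB.
by rewrite -rmorph_sum -rmorphB absC_conj; exact: AP.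
Qed.

Lemma fset_esum_le (h : X -> R) (A : {fset X}) : (forall x, 0 <= h x) ->
  ((\sum_(x <- A) h x)%:E <= \esum_(x in [set: X]) (h x)%:E)%E.
Proof.
move=> h0; apply: ereal_sup_ubound; exists [set` A] => //.
by rewrite fsbig_finite//= set_fsetK sumEFin.
Qed.

Lemma esum_le_fset (h : X -> R) (M : R) : (forall x, 0 <= h x) ->
  (forall A : {fset X}, \sum_(x <- A) h x <= M) ->
  (\esum_(x in [set: X]) (h x)%:E <= M%:E)%E.
Proof.
move=> h0 hM; apply: ge_ereal_sup => _ [A [finA _] <-].
by rewrite fsbig_finite//= sumEFin lee_fin hM.
Qed.

Lemma has_sum_ge0 (h : X -> R) : (forall x, 0 <= h x) ->
  (\esum_(x in [set: X]) (h x)%:E < +oo)%E ->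
  has_sum (fun x => (h x)%:C%C) (fine (\esum_(x in [set: X]) (h x)%:E)%E)%:C%C.
Proof.
move=> h0 hoo e e0.
have fin : (\esum_(x in [set: X]) (h x)%:E)%E \is a fin_num.
  by rewrite ge0_fin_numE// esum_ge0// => x _; rewrite lee_fin.
set s := fine _.
have sE : (\esum_(x in [set: X]) (h x)%:E)%E = s%:E by rewrite fineK.
have [A sA] : exists A : {fset X}, s - e < \sum_(x <- A) h x.
  apply: contrapT => /forallNP hA.
  have : (s%:E <= (s - e)%:E)%E.
    rewrite -sE; apply: esum_le_fset => // A.
    by rewrite leNgt; apply/negP; exact: hA.
  by rewrite lee_fin; lra.
exists A => B AB.
rewrite -rmorph_sum -rmorphB absC_real ltr_norml.
have lB : \sum_(x <- B) h x <= s.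
  by rewrite -lee_fin -sE fset_esum_le.
have lAB : \sum_(x <- A) h x <= \sum_(x <- B) h x.
  rewrite [leRHS](big_fsetID _ (mem A))/=.
  rewrite (_ : [fset x in B | x \in A]%fset = A) ?lerDl ?sumr_ge0//.
  by apply/fsetP => x; rewrite !inE/= andbC;
    case: (boolP (x \in A)) => // /(fsubsetP AB) ->.
by apply/andP; split; lra.
Qed.

End Sums.

(** * The Hilbert space *)

Section Ell2.
Variables (R : realType) (X : choiceType).
Local Notation ell2 := (ell2 R X).
Implicit Types (u v w : ell2) (a b c : R[i]) (A B : set X).

Lemma ell2_eqP u v : (forall x, u x = v x) -> u = v.
Proof. by move=> uv; apply: val_inj; apply/funext. Qed.

Lemma ell2DE u v x : (u + v) x = u x + v x. Proof. by []. Qed.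
Lemma ell2BE u v x : (u - v) x = u x - v x. Proof. by []. Qed.
Lemma ell2ZE a u x : (a *: u) x = a * u x. Proof. by []. Qed.
Lemma ell2_0E x : (0 : ell2) x = 0. Proof. by []. Qed.

Lemma deltaE (x z : X) : delta R x z = (z == x)%:R. Proof. by []. Qed.

Lemma l2norm_ge0 u : 0 <= l2norm u.
Proof. exact: sqrtr_ge0. Qed.

Lemma l2norm_fset u (A : {fset X}) :
  \sum_(x <- A) absC (u x) ^+ 2 <= l2norm u ^+ 2.
Proof.
have uoo := asboolP _ (ell2P u).
rewrite sqr_sqrtr; last by rewrite fine_ge0// esum_ge0// => x _;
  rewrite lee_fin sqr_ge0.
rewrite -lee_fin fineK ?fset_esum_le//; first by move=> x; exact: sqr_ge0.
by rewrite ge0_fin_numE// esum_ge0// => x _; rewrite lee_fin sqr_ge0.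
Qed.

Lemma has_sum_sqr u :
  has_sum (fun x => u x * (u x)^*) (l2norm u ^+ 2)%:C%C.
Proof.
have uoo := asboolP _ (ell2P u).
rewrite sqr_sqrtr; last by rewrite fine_ge0// esum_ge0// => x _;
  rewrite lee_fin sqr_ge0.
have -> : (fun x => u x * (u x)^*) = (fun x => (absC (u x) ^+ 2)%:C%C).
  by apply/funext => x; rewrite mul_conjC.
by apply: has_sum_ge0 => // x; exact: sqr_ge0.
Qed.

(** Polarization: the products are a combination, with coefficients 1/4, -1/4, i/4 and -i/4, of the
    squared moduli of u + k v for k = 1, -1, i, -i, and each of these families is summable by
    [has_sum_sqr]. *)
Lemma has_sum_inner u v : has_sum (fun x => u x * (v x)^*) (inner u v).
Proof.
suff [l hl] : exists l, has_sum (fun x => u x * (v x)^*) l.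
  by rewrite /inner (has_sum_sum hl).
have h0 : @has_sum R X (fun=> 0) 0.
  by move=> e e0; exists fset0 => B _; rewrite big1// subr0 absC0.
pose q (k : R[i]) := (l2norm (u + k *: v) ^+ 2)%:C%C.
have hq (k : R[i]) : has_sum (fun x => (u x + k * v x) * (u x + k * v x)^*) (q k).
  exact: has_sum_sqr (u + k *: v).
have h1 := has_sum_lin (4^-1) (hq 1) h0.
have h2 := has_sum_lin (- 4^-1) (hq (-1)) h1.
have h3 := has_sum_lin ('i / 4) (hq 'i) h2.
have h4 := has_sum_lin (- 'i / 4) (hq (- 'i)) h3.
have [l hl] : exists l, has_sum (fun x => u x * (v x)^*) l; last by exists l.
eexists; congr has_sum: h4; apply/funext => x /=.
rewrite !rmorphD !rmorphM !rmorphN /= rmorph1 conjCi.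
set U := u x; set V := v x; set U' := U^*; set V' := V^*.
have i2 : 'i * 'i = -1 :> R[i] by rewrite -expr2 sqrCi.
transitivity (U * V' * (2^-1 - 'i * 'i / 2) + V * U' * (2^-1 + 'i * 'i / 2)).
  by field.
by rewrite i2; field.
Qed.

Lemma innerDZl a u v w : inner (a *: u + v) w = a * inner u w + inner v w.
Proof.
apply: has_sum_unique (has_sum_inner _ _) _.
have := has_sum_lin a (has_sum_inner u w) (has_sum_inner v w).
by congr has_sum; apply/funext => x; rewrite ell2DE ell2ZE mulrDl mulrA.
Qed.

Lemma innerC u v : inner v u = (inner u v)^*.
Proof.
apply: has_sum_unique (has_sum_inner _ _) _.
have := has_sum_conj (has_sum_inner u v).
by congr has_sum; apply/funext => x; rewrite rmorphM /= conjCK mulrC.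
Qed.

Lemma inner_self u : inner u u = (l2norm u ^+ 2)%:C%C.
Proof. exact: has_sum_unique (has_sum_inner _ _) (has_sum_sqr _). Qed.

Lemma inner0l u : inner 0 u = 0.
Proof.
have := innerDZl 1 0 0 u; rewrite scale1r addr0 mul1r => /eqP.
by rewrite -subr_eq subrr eq_sym => /eqP.
Qed.

Lemma innerDl u v w : inner (u + v) w = inner u w + inner v w.
Proof. by rewrite -[u]scale1r innerDZl mul1r scale1r. Qed.

Lemma innerZl a u v : inner (a *: u) v = a * inner u v.
Proof. by rewrite -[a *: u]addr0 innerDZl inner0l addr0. Qed.

Lemma innerNl u v : inner (- u) v = - inner u v.
Proof. by rewrite -scaleN1r innerZl mulN1r. Qed.

Lemma innerBl u v w : inner (u - v) w = inner u w - inner v w.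
Proof. by rewrite innerDl innerNl. Qed.

Lemma inner0r u : inner u 0 = 0.
Proof. by rewrite innerC inner0l rmorph0. Qed.

Lemma innerDr u v w : inner w (u + v) = inner w u + inner w v.
Proof. by rewrite innerC innerDl rmorphD /= -!innerC. Qed.

Lemma innerZr a u v : inner v (a *: u) = a^* * inner v u.
Proof. by rewrite innerC innerZl rmorphM /= -innerC. Qed.

Lemma innerNr u v : inner v (- u) = - inner v u.
Proof. by rewrite -scaleN1r innerZr rmorphN /= rmorph1 mulN1r. Qed.

Lemma innerBr u v w : inner w (u - v) = inner w u - inner w v.
Proof. by rewrite innerDr innerNr. Qed.

Lemma inner_suml (I : Type) (s : seq I) (P : pred I) (F : I -> ell2) u :
  inner (\sum_(i <- s | P i) F i) u = \sum_(i <- s | P i) inner (F i) u.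
Proof.
by apply: (big_morph (fun w => inner w u)) => [v w|]; rewrite ?innerDl ?inner0l.
Qed.

Lemma inner_sumr (I : Type) (s : seq I) (P : pred I) (F : I -> ell2) u :
  inner u (\sum_(i <- s | P i) F i) = \sum_(i <- s | P i) inner u (F i).
Proof. by apply: (big_morph (inner u)) => [v w|];
  rewrite ?innerDr ?inner0r. Qed.

Lemma ell2_sumE (I : Type) (s : seq I) (P : pred I) (F : I -> ell2) x :
  (\sum_(i <- s | P i) F i) x = \sum_(i <- s | P i) F i x.
Proof. by apply: (big_morph (fun w : ell2 => w x)) => [v w|]. Qed.

Lemma inner_delta u x : inner u (delta R x) = u x.
Proof.
apply: has_sum_unique (has_sum_inner _ _) _ => e e0.
exists [fset x]%fset => B xB.
rewrite (big_fsetD1 x)/=; last by rewrite (fsubsetP xB)// inE.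
rewrite ?deltaE eqxx conjC1 mulr1 addrAC subrr add0r big_seq big1 ?absC0//.
by move=> y; rewrite !inE ?deltaE => /andP[/negPf-> _]; rewrite conjC0 mulr0.
Qed.

Lemma delta_inner u x : inner (delta R x) u = (u x)^*.
Proof. by rewrite innerC inner_delta. Qed.

Lemma l2norm_sqrE u : l2norm u ^+ 2 = complex.Re (inner u u).
Proof. by rewrite inner_self. Qed.

Lemma l2norm_eq0 u : l2norm u = 0 -> u = 0.
Proof.
move=> u0; apply: ell2_eqP => x; rewrite ell2_0E; apply/eqP.
rewrite -absC_eq0 -sqrf_eq0 eq_le sqr_ge0 andbT.
by have := l2norm_fset u [fset x]%fset; rewrite big_seq_fset1 u0 expr0n.
Qed.

Lemma l2norm0 : l2norm (0 : ell2) = 0.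
Proof.
by apply/eqP; rewrite -sqrf_eq0 l2norm_sqrE inner0l.
Qed.

Lemma inner_self0 u : inner u u = 0 -> u = 0.
Proof.
by move=> u0; apply: l2norm_eq0; apply/eqP; rewrite -sqrf_eq0 l2norm_sqrE u0.
Qed.

Lemma l2norm_delta (x : X) : l2norm (delta R x) = 1.
Proof.
apply/eqP; rewrite -(@eqrXn2 _ 2)// ?l2norm_ge0// expr1n.
by rewrite l2norm_sqrE inner_delta deltaE eqxx.
Qed.

Lemma cauchy_schwarz u v : absC (inner u v) <= l2norm u * l2norm v.
Proof.
have [v0|v0] := eqVneq (l2norm v) 0.
  by rewrite v0 (l2norm_eq0 v0) inner0r absC0 mulr0.
have vpos : 0 < l2norm v by rewrite lt_def v0 l2norm_ge0.
rewrite -(@ler_pXn2r _ 2)// ?nnegrE ?mulr_ge0 ?absC_ge0 ?l2norm_ge0//.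
have [p [ppos pE]] : exists p, 0 < p /\ p = l2norm v ^+ 2 by exists (l2norm v ^+ 2); rewrite exprn_gt0.
(* This vector is |v|^2 times the component of u orthogonal to v, which avoids a division; its
   squared norm is p (p r - a), with a = |<u, v>|^2. *)
have := sqr_ge0 (l2norm (p%:C%C *: u - inner u v *: v)).
rewrite l2norm_sqrE innerBl !innerBr !innerZl !innerZr !inner_self (innerC u v).
rewrite conjC_real_complex -pE; set z := inner u v; set r := l2norm u ^+ 2.
have [a aE zE] : exists2 a, a = absC z ^+ 2 & z * z^* = a%:C%C.
  by eexists; last exact: mul_conjC.
set t := (X in complex.Re X); have -> : t = (p * (p * r - a))%:C%C.
  rewrite [RHS]rmorphM rmorphB rmorphM /= -zE /t; ring.
rewrite aE.
by rewrite /= pmulr_rge0// subr_ge0 exprMn mulrC -pE.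
Qed.

Lemma l2normD u v : l2norm (u + v) <= l2norm u + l2norm v.
Proof.
rewrite -(@ler_pXn2r _ 2)// ?nnegrE ?addr_ge0 ?l2norm_ge0//.
rewrite l2norm_sqrE innerDl !innerDr !raddfD/= -!l2norm_sqrE.
have : complex.Re (inner u v) <= absC (inner u v).
  apply: le_trans (ler_norm _) _.
  by have := normc_ge_Re (inner u v); rewrite absCE /= lecR.
move=> /le_trans/(_ (cauchy_schwarz u v)).
have -> : complex.Re (inner v u) = complex.Re (inner u v).
  by rewrite innerC; case: (inner u v).
move: (complex.Re _) (l2norm u) (l2norm v) => r s t; nra.
Qed.

Lemma l2normZ a u : l2norm (a *: u) = absC a * l2norm u.
Proof.
apply/eqP; rewrite -(@eqrXn2 _ 2)// ?mulr_ge0 ?absC_ge0 ?l2norm_ge0//.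
rewrite l2norm_sqrE innerZl innerZr mulrA mul_conjC inner_self -rmorphM /=.
by rewrite exprMn.
Qed.

Lemma l2normN u : l2norm (- u) = l2norm u.
Proof. by rewrite -scaleN1r l2normZ absCN absC1 mul1r. Qed.

Lemma pythagoras u v : inner u v = 0 ->
  l2norm (u + v) ^+ 2 = l2norm u ^+ 2 + l2norm v ^+ 2.
Proof.
move=> uv;
  rewrite l2norm_sqrE innerDl !innerDr (innerC u v) uv conjC0 addr0 add0r.
by rewrite !inner_self.
Qed.

Lemma square_summable_bound (f : X -> R[i]) (M : R) :
  (forall A : {fset X}, \sum_(x <- A) absC (f x) ^+ 2 <= M) ->
  f \in @square_summable R X.
Proof.
move=> fM; apply/asboolP; apply: le_lt_trans (ltry M).
by apply: esum_le_fset => // x; exact: sqr_ge0.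
Qed.

Lemma l2norm_bound u (M : R) :
  (forall A : {fset X}, \sum_(x <- A) absC (u x) ^+ 2 <= M) -> l2norm u ^+ 2 <= M.
Proof.
move=> uM; have uoo := asboolP _ (ell2P u).
rewrite sqr_sqrtr; last by rewrite fine_ge0// esum_ge0// => x _;
  rewrite lee_fin sqr_ge0.
rewrite -lee_fin fineK ?esum_le_fset//; first by move=> x; exact: sqr_ge0.
by rewrite ge0_fin_numE// esum_ge0// => x _; rewrite lee_fin sqr_ge0.
Qed.

Lemma res_subproof A u :
  (fun x => if x \in A then u x else 0) \in @square_summable R X.
Proof.
apply: (@square_summable_bound _ (l2norm u ^+ 2)) => B.
apply: le_trans (l2norm_fset u B); apply: ler_sum => x _.
by case: ifP => // _; rewrite absC0 expr0n sqr_ge0.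
Qed.

(** The indicator function of [A] as a projection in l_infty; [chi x] is the case of a singleton,
    see [chiE]. *)
Definition res A u : ell2 := Ell2 (res_subproof A u).

Lemma resE A u x : res A u x = if x \in A then u x else 0.
Proof. by []. Qed.

Lemma res_linear A : linear (res A).
Proof.
move=> k u v; apply: ell2_eqP => x; rewrite ell2DE ell2ZE !resE.
by case: ifP => // _; rewrite mulr0 addr0.
Qed.

Lemma res_inner A u v : inner (res A u) v = inner u (res A v).
Proof.
apply: has_sum_unique (has_sum_inner _ _) _.
have := has_sum_inner u (res A v); congr has_sum; apply/funext => x.
by rewrite !resE; case: ifP => // _; rewrite conjC0 mulr0 mul0r.
Qed.

Lemma res_idem A u : res A (res A u) = res A u.
Proof. by apply: ell2_eqP => x; rewrite !resE; case: (x \in A). Qed.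

Lemma l2norm_res_sub A B u : A `<=` B -> l2norm (res A u) <= l2norm (res B u).
Proof.
move=> AB; rewrite -(@ler_pXn2r _ 2)// ?nnegrE ?l2norm_ge0//.
apply: l2norm_bound => C; apply: le_trans (l2norm_fset (res B u) C).
apply: ler_sum => x _; rewrite !resE.
case: ifPn => [|_]; last by rewrite absC0 expr0n sqr_ge0.
by move=> /set_mem/AB xB; rewrite ifT//; exact: mem_set.
Qed.

Lemma res_setT u : res setT u = u.
Proof. by apply: ell2_eqP => x; rewrite resE in_setT. Qed.

Lemma l2norm_res A u : l2norm (res A u) <= l2norm u.
Proof. by rewrite -[in leRHS](res_setT u); apply: l2norm_res_sub. Qed.

Lemma resU A B u : A `&` B = set0 -> res (A `|` B) u = res A u + res B u.
Proof.
move=> AB; apply: ell2_eqP => x; rewrite ell2DE !resE in_setU.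
case: (boolP (x \in A)) => xA; case: (boolP (x \in B)) => xB /=;
  rewrite ?addr0 ?add0r//.
by exfalso; have : (A `&` B) x; [split; exact: set_mem|rewrite AB].
Qed.

Lemma resC A u : res (~` A) u = u - res A u.
Proof.
apply: ell2_eqP => x; rewrite ell2BE !resE in_setC.
by case: (x \in A); rewrite /= ?subrr ?subr0.
Qed.

Lemma sum_deltaE (f : X -> R[i]) (A : {fset X}) x :
  (\sum_(y <- A) f y *: delta R y) x = if x \in A then f x else 0.
Proof.
rewrite ell2_sumE (eq_bigr (fun y => f y * (x == y)%:R)); last first.
  by move=> y _; rewrite ell2ZE deltaE.
case: ifPn => xA.
  rewrite (big_fsetD1 x)//= eqxx mulr1 big_seq big1 ?addr0//.
  by move=> y; rewrite !inE => /andP[/negPf yx _]; rewrite eq_sym yx mulr0.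
rewrite big_seq big1// => y yA; case: eqP => [xy|_]; last by rewrite mulr0.
by move: xA; rewrite xy yA.
Qed.

Lemma res_fset (A : {fset X}) u :
  res [set` A] u = \sum_(x <- A) u x *: delta R x.
Proof. by apply: ell2_eqP => x; rewrite sum_deltaE resE mem_setE. Qed.

Lemma l2norm_res_split A u :
  l2norm u ^+ 2 = l2norm (res A u) ^+ 2 + l2norm (res (~` A) u) ^+ 2.
Proof.
rewrite -pythagoras; first by rewrite resC addrC subrK.
rewrite res_inner; have -> : res A (res (~` A) u) = 0.
  by apply: ell2_eqP => x; rewrite !resE in_setC; case: (x \in _).
by rewrite inner0r.
Qed.

Lemma l2norm_res_fset (A : {fset X}) u :
  l2norm (res [set` A] u) ^+ 2 = \sum_(x <- A) absC (u x) ^+ 2.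
Proof.
rewrite l2norm_sqrE res_inner res_idem -res_inner res_fset inner_suml.
rewrite raddf_sum; apply: eq_bigr => x _.
by rewrite innerZl delta_inner mul_conjC.
Qed.

Lemma res_approx u (e : R) : 0 < e ->
  exists A : {fset X}, l2norm (res (~` [set` A]) u) < e.
Proof.
move=> e0; have [A AP] := has_sum_sqr u (exprn_gt0 2 (divr_gt0 e0 (ltr0n _ 2))).
exists A; apply: (@le_lt_trans _ _ (e / 2));
  last by rewrite ltr_pdivrMr// mulr2n mulrDr mulr1 ltrDl.
rewrite -(@ler_pXn2r _ 2)// ?nnegrE ?l2norm_ge0 ?divr_ge0 ?(ltW e0)//.
have /(_ (fsubset_refl A)) := AP A.
rewrite (eq_bigr (fun x => (absC (u x) ^+ 2)%:C%C)); last by move=> x _;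
  rewrite mul_conjC.
rewrite -rmorph_sum -rmorphB absC_real distrC => /ltW; apply: le_trans.
rewrite (l2norm_res_split [set` A] u) -l2norm_res_fset.
by rewrite addrAC subrr add0r ler_norm.
Qed.

Lemma res1 x u : res [set x] u = u x *: delta R x.
Proof.
apply: ell2_eqP => z; rewrite resE ell2ZE deltaE.
by rewrite classical_sets.in_set1; case: eqP => [->|_]; rewrite ?mulr1 ?mulr0.
Qed.

Lemma chiE x : chi x = res [set x].
Proof. by apply/funext => u; rewrite res1 /chi inner_delta. Qed.

End Ell2.

(** * Bounded operators and adjoints *)

Section BoundedOperators.
Variables (R : realType) (X : choiceType).
Local Notation ell2 := (ell2 R X).
Local Notation op := (operator R X).
Implicit Types (u v w : ell2) (a b : op) (c : R[i]).

Lemma op0E u : (0 : op) u = 0. Proof. by []. Qed.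
Lemma opDE a b u : (a + b) u = a u + b u. Proof. by []. Qed.
Lemma opNE a u : (- a) u = - a u. Proof. by []. Qed.
Lemma opZE c a u : (c *: a) u = c *: a u. Proof. by []. Qed.
Definition opE := (op0E, opDE, opNE, opZE).

Section Linear.
Variable a : op.
Hypothesis ba : bounded_op a.

Lemma bop_lin c u v : a (c *: u + v) = c *: a u + a v.
Proof. by case: ba => + _; apply. Qed.

Lemma bop0 : a 0 = 0.
Proof.
have := bop_lin 1 0 0; rewrite !scale1r !addr0 => /eqP.
by rewrite -subr_eq subrr eq_sym => /eqP.
Qed.

Lemma bopD u v : a (u + v) = a u + a v.
Proof. by rewrite -[u]scale1r bop_lin !scale1r. Qed.

Lemma bopZ c u : a (c *: u) = c *: a u.
Proof. by rewrite -[c *: u]addr0 bop_lin bop0 addr0. Qed.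

Lemma bopB u v : a (u - v) = a u - a v.
Proof. by rewrite bopD -(scaleN1r v) bopZ scaleN1r. Qed.

Lemma bop_sum (I : Type) (s : seq I) (P : pred I) (F : I -> ell2) :
  a (\sum_(i <- s | P i) F i) = \sum_(i <- s | P i) a (F i).
Proof. by apply: (big_morph a) => [u v|]; rewrite ?bopD ?bop0. Qed.

(** [sup] is meaningful only for nonempty sets bounded above; this is what lets [opnorm] bound
    [l2norm (a u)]. *)
Lemma has_sup_opnorm :
  has_sup [set l2norm (a u) | u in [set u : ell2 | l2norm u <= 1]].
Proof.
split; first by exists (l2norm (a 0)), 0 => //=; rewrite l2norm0.
case: ba => _ [M MP]; exists (`|M|) => _ [u /= u1 <-].
apply: le_trans (MP u) _; apply: (@le_trans _ _ (`|M| * l2norm u)).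
  by rewrite ler_wpM2r ?l2norm_ge0 ?ler_norm.
by rewrite ler_piMr.
Qed.

Lemma opnorm_ge0 : 0 <= opnorm a.
Proof.
have [_ ub] := has_sup_opnorm; apply: le_trans (l2norm_ge0 (a 0)) _.
by apply: ub_le_sup => //; exists 0 => //=; rewrite l2norm0.
Qed.

Lemma l2norm_bop u : l2norm (a u) <= opnorm a * l2norm u.
Proof.
have [u0|u0] := eqVneq (l2norm u) 0.
  by rewrite (l2norm_eq0 u0) bop0 l2norm0 mulr0.
have upos : 0 < l2norm u by rewrite lt_def u0 l2norm_ge0.
have -> : a u = (l2norm u)%:C%C *: a ((l2norm u)^-1%:C%C *: u).
  by rewrite -bopZ scalerA -rmorphM mulfV// scale1r.
rewrite l2normZ absC_real (ger0_norm (l2norm_ge0 u)) mulrC ler_wpM2r ?l2norm_ge0//.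
have [_ ub] := has_sup_opnorm; apply: ub_le_sup => //.
eexists; last by [].
by rewrite /= l2normZ absC_real ger0_norm ?invr_ge0 ?l2norm_ge0// mulVf.
Qed.

End Linear.

Lemma opnorm_le a (M : R) : 0 <= M ->
  (forall u, l2norm (a u) <= M * l2norm u) -> opnorm a <= M.
Proof.
move=> M0 aM; apply: ge_sup; first by exists (l2norm (a 0)), 0 => //=;
  rewrite l2norm0.
by move=> _ [u /= u1 <-]; apply: le_trans (aM u) _; rewrite ler_piMr.
Qed.

Lemma bounded_op_opnorm a (M : R) : linear a ->
  (forall u, l2norm (a u) <= M * l2norm u) -> bounded_op a.
Proof. by move=> la aM; split=> //; exists M. Qed.

Lemma bounded_op0 : bounded_op (0 : op).
Proof.
apply: (@bounded_op_opnorm _ 0) => [k u v|u];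
  first by rewrite !opE scaler0 addr0.
by rewrite opE l2norm0 mul0r.
Qed.

Lemma bounded_opDZ c a b : bounded_op a -> bounded_op b -> bounded_op (c *: a + b).
Proof.
move=> ba bb;
  apply: (@bounded_op_opnorm _ (absC c * opnorm a + opnorm b)) => [k u v|u].
  rewrite !opE (bop_lin ba) (bop_lin bb) !scalerDr !scalerA mulrC.
  by rewrite addrACA.
rewrite !opE; apply: le_trans (l2normD _ _) _; rewrite l2normZ mulrDl -mulrA.
by rewrite lerD ?ler_wpM2l ?absC_ge0 ?l2norm_bop.
Qed.

Lemma bounded_opB a b : bounded_op a -> bounded_op b -> bounded_op (a - b).
Proof. by move=> ba bb; rewrite addrC -(scaleN1r b); apply: bounded_opDZ. Qed.

Lemma bounded_op_comp a b : bounded_op a -> bounded_op b -> bounded_op (a \o b).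
Proof.
move=> ba bb;
  apply: (@bounded_op_opnorm _ (opnorm a * opnorm b)) => [k u v|u] /=.
  by rewrite (bop_lin bb) (bop_lin ba).
apply: le_trans (l2norm_bop ba _) _; rewrite -mulrA ler_wpM2l ?opnorm_ge0//.
exact: l2norm_bop.
Qed.

Lemma bounded_op_res (A : set X) : bounded_op (@res R X A).
Proof.
apply: (@bounded_op_opnorm _ 1); first exact: res_linear.
by move=> u; rewrite mul1r l2norm_res.
Qed.

Lemma bounded_op_chi (x : X) : bounded_op (@chi R X x).
Proof. by rewrite chiE; exact: bounded_op_res. Qed.

Lemma l2norm_sum_delta (f : X -> R[i]) (A : {fset X}) :
  l2norm (\sum_(x <- A) f x *: delta R x) ^+ 2 = \sum_(x <- A) absC (f x) ^+ 2.
Proof.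
rewrite l2norm_sqrE inner_suml raddf_sum big_seq [RHS]big_seq.
apply: eq_bigr => x xA.
by rewrite innerZl delta_inner sum_deltaE xA mul_conjC.
Qed.

Lemma inner_eq u v : (forall w, inner w u = inner w v) -> u = v.
Proof.
move=> uv; apply/eqP; rewrite -subr_eq0; apply/eqP/inner_self0.
by rewrite innerBr uv subrr.
Qed.

(** Riesz representation in coordinates: the coordinate of [b v] at x has to be
    [inner v (a (delta R x))]. A bound on finite partial sums makes this square summable, and the
    identity passes from finitely supported u to all u by approximation. *)
Lemma adj_exists a : bounded_op a ->
  exists b, bounded_op b /\ forall u v, inner (a u) v = inner u (b v).
Proof.
move=> ba; pose f v x := inner v (a (delta R x)).
have fS v : f v \in @square_summable R X.
  apply: (@square_summable_bound _ _ _ ((opnorm a * l2norm v) ^+ 2)) => A.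
  (* With [w] the truncation of [f v] to [A], |w|^2 = |<v, a w>| <= |v| |a| |w|, and one factor |w|
     cancels. *)
  rewrite -l2norm_sum_delta; set w := \sum_(_ <- _) _.
  suff : l2norm w <= opnorm a * l2norm v.
    by move=> ?; rewrite ler_pXn2r// nnegrE ?mulr_ge0 ?opnorm_ge0 ?l2norm_ge0.
  have [w0|w0] := eqVneq (l2norm w) 0.
    by rewrite w0 mulr_ge0 ?opnorm_ge0 ?l2norm_ge0.
  have wpos : 0 < l2norm w by rewrite lt_def w0 l2norm_ge0.
  rewrite -(ler_pM2r wpos) -expr2.
  have <- : absC (inner v (a w)) = l2norm w ^+ 2.
    rewrite (bop_sum ba) inner_sumr l2norm_sum_delta.
    rewrite (eq_bigr (fun x => (absC (f v x) ^+ 2)%:C%C)).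
      rewrite -rmorph_sum absC_real ger0_norm// sumr_ge0// => x _.
      exact: sqr_ge0.
    by move=> x _; rewrite (bopZ ba) innerZr mulrC mul_conjC.
  apply: le_trans (cauchy_schwarz _ _) _.
  rewrite mulrC [leRHS]mulrAC ler_wpM2r ?l2norm_ge0//.
  exact: l2norm_bop.
pose b v : ell2 := Ell2 (fS v).
have bP u v : inner (a u) v = inner u (b v).
  apply/esym/(has_sum_unique (has_sum_inner _ _)) => e e0.
  have K0 : 0 < opnorm a * l2norm v + 1.
    by rewrite ltr_wpDl ?mulr_ge0 ?opnorm_ge0 ?l2norm_ge0.
  have [A AP] := res_approx u (divr_gt0 e0 K0).
  exists A => B AB.
  have -> : \sum_(x <- B) u x * (b v x)^* = inner (a (res [set` B] u)) v.
    rewrite res_fset (bop_sum ba) inner_suml; apply: eq_bigr => x _.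
    by rewrite (bopZ ba) innerZl -innerC.
  rewrite -innerBl -(bopB ba); apply: le_lt_trans (cauchy_schwarz _ _) _.
  have -> : res [set` B] u - u = - res (~` [set` B]) u by rewrite resC opprB.
  apply: (@le_lt_trans _ _ (opnorm a * l2norm (res (~` [set` A]) u) * l2norm v)).
    rewrite ler_wpM2r ?l2norm_ge0//; apply: le_trans (l2norm_bop ba _) _.
    rewrite ler_wpM2l ?opnorm_ge0// l2normN; apply: l2norm_res_sub.
    by apply: subsetC => x; exact: (fsubsetP AB).
  rewrite mulrAC; have := AP; rewrite ltr_pdivlMr// => /le_lt_trans; apply.
  by rewrite mulrC ler_wpM2l ?l2norm_ge0// lerDl.
exists b; split=> //; apply: (@bounded_op_opnorm _ (opnorm a)).
  move=> k v w; apply: inner_eq => z.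
  by rewrite innerDr innerZr -!bP innerDr innerZr.
(* The same cancellation bounds [b], from |b v|^2 = <a (b v), v>. *)
move=> v; have [->|v0] := eqVneq (l2norm (b v)) 0.
  by rewrite mulr_ge0 ?opnorm_ge0 ?l2norm_ge0.
have vpos : 0 < l2norm (b v) by rewrite lt_def v0 l2norm_ge0.
rewrite -(ler_pM2r vpos) -expr2.
have <- : absC (inner (b v) (b v)) = l2norm (b v) ^+ 2.
  by rewrite inner_self absC_real ger0_norm ?sqr_ge0.
rewrite -bP; apply: le_trans (cauchy_schwarz _ _) _.
by rewrite mulrAC ler_wpM2r ?l2norm_ge0// l2norm_bop.
Qed.

Lemma adjP a : bounded_op a ->
  bounded_op (adj a) /\ forall u v, inner (a u) v = inner u (adj a v).
Proof. by move=> /adj_exists/(xgetPex 0). Qed.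

Lemma adj_unique a b : bounded_op a ->
  (forall u v, inner (a u) v = inner u (b v)) -> adj a = b.
Proof.
move=> ba ab; apply/funext => v; apply: inner_eq => u.
by rewrite -ab; apply/esym; have [_] := adjP ba; apply.
Qed.

Lemma bounded_op_adj a : bounded_op a -> bounded_op (adj a).
Proof. by move=> /adjP[]. Qed.

Lemma inner_adj a u v : bounded_op a -> inner (a u) v = inner u (adj a v).
Proof. by move=> /adjP[]. Qed.

Lemma inner_adjr a u v : bounded_op a -> inner (adj a u) v = inner u (a v).
Proof. by move=> ba; rewrite innerC -inner_adj// -innerC. Qed.

Lemma adjK a : bounded_op a -> adj (adj a) = a.
Proof.
move=> ba; apply: adj_unique; first exact: bounded_op_adj.
by move=> u v; rewrite inner_adjr.
Qed.

Lemma adjB a b : bounded_op a -> bounded_op b -> adj (a - b) = adj a - adj b.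
Proof.
move=> ba bb; apply: adj_unique; first exact: bounded_opB.
by move=> u v; rewrite !opE innerBl innerBr !inner_adj.
Qed.

Lemma adj_comp a b : bounded_op a -> bounded_op b ->
  adj (a \o b) = adj b \o adj a.
Proof.
move=> ba bb; apply: adj_unique; first exact: bounded_op_comp.
by move=> u v /=; rewrite !inner_adj.
Qed.

Lemma adj_res (A : set X) : adj (@res R X A) = res A.
Proof. by apply: adj_unique (@bounded_op_res A) _; exact: res_inner. Qed.

Lemma opnorm_adj a : bounded_op a -> opnorm (adj a) <= opnorm a.
Proof.
move=> ba; apply: opnorm_le => [|u]; first exact: opnorm_ge0.
have [->|u0] := eqVneq (l2norm (adj a u)) 0.
  by rewrite mulr_ge0 ?opnorm_ge0 ?l2norm_ge0.
have upos : 0 < l2norm (adj a u) by rewrite lt_def u0 l2norm_ge0.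
rewrite -(ler_pM2r upos) -expr2.
have <- : absC (inner (adj a u) (adj a u)) = l2norm (adj a u) ^+ 2.
  by rewrite inner_self absC_real ger0_norm ?sqr_ge0.
rewrite inner_adjr//; apply: le_trans (cauchy_schwarz _ _) _.
by rewrite mulrC [leRHS]mulrAC ler_wpM2r ?l2norm_ge0// l2norm_bop.
Qed.

Lemma opnormDZ c a b : bounded_op a -> bounded_op b ->
  opnorm (c *: a + b) <= absC c * opnorm a + opnorm b.
Proof.
move=> ba bb; apply: opnorm_le => [|u].
  by rewrite addr_ge0 ?mulr_ge0 ?absC_ge0 ?opnorm_ge0.
rewrite !opE; apply: le_trans (l2normD _ _) _; rewrite l2normZ mulrDl -mulrA.
by rewrite lerD ?ler_wpM2l ?absC_ge0 ?l2norm_bop.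
Qed.

Lemma opnormD a b : bounded_op a -> bounded_op b ->
  opnorm (a + b) <= opnorm a + opnorm b.
Proof.
move=> ba bb; have := opnormDZ 1 ba bb.
by rewrite scale1r absC1 mul1r.
Qed.

Lemma opnorm_comp a b : bounded_op a -> bounded_op b ->
  opnorm (a \o b) <= opnorm a * opnorm b.
Proof.
move=> ba bb; apply: opnorm_le => [|u]; first by rewrite mulr_ge0 ?opnorm_ge0.
apply: le_trans (l2norm_bop ba _) _; rewrite -mulrA ler_wpM2l ?opnorm_ge0//.
exact: l2norm_bop.
Qed.

Lemma opnorm0 : opnorm (0 : op) = 0.
Proof.
apply/eqP; rewrite eq_le opnorm_ge0 ?andbT; last exact: bounded_op0.
by apply: opnorm_le => // u; rewrite opE l2norm0 mul0r.
Qed.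

Lemma sub_norm_closure (S : set op) : S `<=` @bounded_op R X ->
  S `<=` norm_closure S.
Proof.
move=> Sb a Sa; split; first exact: Sb.
by move=> e e0; exists a => //; rewrite subrr opnorm0.
Qed.

(** Adjoints replace a density argument: equal matrices make the adjoints agree on each [delta R x],
    and the coordinate of [a u] at x is the inner product of u with [adj a (delta R x)]. *)
Lemma op_ext_delta a b : bounded_op a -> bounded_op b ->
  (forall x z, a (delta R z) x = b (delta R z) x) -> a = b.
Proof.
move=> ba bb ab; apply/funext => u.
have abd x : adj a (delta R x) = adj b (delta R x).
  apply: ell2_eqP => z.
  by rewrite -!inner_delta (inner_adjr _ _ ba) (inner_adjr _ _ bb) !delta_inner ab.
apply: ell2_eqP => x.
by rewrite -!inner_delta (inner_adj _ _ ba) (inner_adj _ _ bb) abd.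
Qed.

End BoundedOperators.

(** * Orthonormal families and the gliding hump *)

Section Orthonormal.
Variables (R : realType) (X Y : choiceType) (xi : X -> ell2 R Y).
Hypothesis xi_on : forall x z, inner (xi x) (xi z) = (x == z)%:R.
Implicit Types (u v : ell2 R Y) (s : {fset X}).

(** For an orthonormal family, the orthogonal projection onto the span of the [xi w] with w in
    [s]. *)
Definition span_proj s u := \sum_(w <- s) inner u (xi w) *: xi w.

Lemma span_proj_lin s c u v : span_proj s (c *: u + v) = c *: span_proj s u + span_proj s v.
Proof.
rewrite /span_proj scaler_sumr -big_split; apply: eq_bigr => w _ /=.
by rewrite innerDl innerZl scalerDl scalerA.
Qed.

Lemma span_projZ s c u : span_proj s (c *: u) = c *: span_proj s u.
Proof.
rewrite /span_proj scaler_sumr; apply: eq_bigr => w _.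
by rewrite innerZl scalerA.
Qed.

Lemma span_proj0 s : span_proj s 0 = 0.
Proof. by rewrite /span_proj big1// => w _; rewrite inner0l scale0r. Qed.

Lemma span_proj_sum s (I : Type) (r : seq I) (F : I -> ell2 R Y) :
  span_proj s (\sum_(i <- r) F i) = \sum_(i <- r) span_proj s (F i).
Proof.
apply: (big_morph (span_proj s)) => [u v|]; last exact: span_proj0.
by have := span_proj_lin s 1 u v; rewrite !scale1r.
Qed.

Lemma span_proj_inner s u w : inner (span_proj s u) (xi w) = if w \in s then inner u (xi w) else 0.
Proof.
rewrite inner_suml (eq_bigr (fun z => inner u (xi z) * (z == w)%:R));
  last first.
  by move=> z _; rewrite innerZl xi_on.
case: ifPn => ws.
  rewrite (big_fsetD1 w)//= eqxx mulr1 big_seq big1 ?addr0//.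
  by move=> y; rewrite !inE => /andP[/negPf yx _]; rewrite yx mulr0.
rewrite big_seq big1// => y ys; case: eqP => [yw|_]; last by rewrite mulr0.
by move: ws; rewrite -yw ys.
Qed.

Lemma span_proj_perp s u w : w \in s -> inner (u - span_proj s u) (xi w) = 0.
Proof. by move=> ws; rewrite innerBl span_proj_inner ws subrr. Qed.

Lemma inner_span_proj_perp s u v : inner (u - span_proj s u) (span_proj s v) = 0.
Proof.
rewrite inner_sumr big_seq big1// => w ws.
by rewrite innerZr span_proj_perp// mulr0.
Qed.

Lemma l2norm_span_proj s u :
  l2norm (span_proj s u) ^+ 2 = \sum_(w <- s) absC (inner u (xi w)) ^+ 2.
Proof.
rewrite l2norm_sqrE {2}/span_proj inner_sumr raddf_sum big_seq [RHS]big_seq.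
by apply: eq_bigr => w ws; rewrite innerZr span_proj_inner ws mulrC mul_conjC.
Qed.

Lemma span_proj_pythagoras s u :
  l2norm u ^+ 2 = l2norm (span_proj s u) ^+ 2 + l2norm (u - span_proj s u) ^+ 2.
Proof.
rewrite -pythagoras; first by rewrite addrC subrK.
by rewrite innerC inner_span_proj_perp conjC0.
Qed.

Lemma bessel s u : \sum_(w <- s) absC (inner u (xi w)) ^+ 2 <= l2norm u ^+ 2.
Proof.
by rewrite -l2norm_span_proj (span_proj_pythagoras s u) lerDl sqr_ge0.
Qed.

Lemma l2norm_xi x : l2norm (xi x) = 1.
Proof.
apply/eqP; rewrite -(@eqrXn2 _ 2)// ?l2norm_ge0// expr1n.
by rewrite l2norm_sqrE xi_on eqxx.
Qed.

End Orthonormal.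

(** * Choice of signs *)

Section SignChoice.
Variables (R : realType) (Y I : choiceType).

Lemma parallelogram (u v : ell2 R Y) :
  l2norm (u + v) ^+ 2 + l2norm (u - v) ^+ 2 = 2 * (l2norm u ^+ 2 + l2norm v ^+ 2).
Proof.
rewrite !l2norm_sqrE innerBl innerDl !innerBr !innerDr !raddfB !raddfD /=; ring.
Qed.

(* Signs are picked one at a time: by the parallelogram law one of
   [u + v], [u - v] has squared norm at most |u|^2 + |v|^2. *)
Lemma sign_choice (f : I -> ell2 R Y) (s : seq I) : uniq s ->
  exists t : I -> bool, l2norm (\sum_(i <- s) (-1) ^+ t i *: f i) ^+ 2
    <= \sum_(i <- s) l2norm (f i) ^+ 2.
Proof.
elim: s => [_|i s IH /= /andP[iNs us]].
  by exists xpredT; rewrite !big_nil l2norm0 expr0n.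
have [t tP] := IH us; set S := \sum_(_ <- _) _ in tP.
have key (b : bool) : l2norm ((-1) ^+ b *: f i + S) ^+ 2 <= l2norm (f i) ^+ 2 + \sum_(i <- s) l2norm (f i) ^+ 2 ->
    exists t : I -> bool, l2norm (\sum_(i <- i :: s) (-1) ^+ t i *: f i) ^+ 2
    <= \sum_(i <- i :: s) l2norm (f i) ^+ 2.
  move=> H; exists (fun j => if j == i then b else t j).
  rewrite !big_cons eqxx; move: H; congr (l2norm (_ + _) ^+ 2 <= _).
  rewrite /S big_seq [RHS]big_seq; apply: eq_bigr => j js.
  by case: eqP => // ji; move: iNs; rewrite -ji js.
have [h|h] := leP (l2norm (S + f i) ^+ 2) (l2norm (f i) ^+ 2 + \sum_(i <- s) l2norm (f i) ^+ 2).
  by apply: (key false); rewrite scale1r addrC.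
apply: (key true); rewrite scaleN1r addrC.
have := parallelogram S (f i).
move: (l2norm (S + _)) (l2norm (S - _)) (l2norm S) h tP => p q r h tP E.
lra.
Qed.

End SignChoice.

(** * Control by the relations T_n, uniformly over finite sets, and its consequences *)

Section EquiApproximability.
Variables (R : realType) (X Y : choiceType) (xi : X -> ell2 R Y).
Variable T : nat -> set (X * X).
Hypothesis xi_on : forall x z, inner (xi x) (xi z) = (x == z)%:R.
Hypothesis T_mono : forall m n, (m <= n)%N -> T m `<=` T n.
Implicit Types (u v : ell2 R Y) (x w : X) (A : set Y) (D Z : {fset Y}).

Definition outside n x v := forall w, T n (x, w) -> inner v (xi w) = 0.

(* The distance from [res A (xi x)] to the span of the [xi w] with
   [T n (x, w)] is at most [eta], for every [x]. *)
Definition controlled n (eta : R) A := forall x v, outside n x v ->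
  absC (inner (res A (xi x)) v) <= eta * l2norm v.

Hypothesis T_controls : forall A (eta : R), 0 < eta -> exists n, controlled n eta A.

Lemma controlled_mono m n eta A : (m <= n)%N -> controlled m eta A -> controlled n eta A.
Proof.
by move=> mn mA x v nv; apply: mA => w Tw; apply: nv; exact: T_mono Tw.
Qed.

(** [Z] has finitely many subsets, so the largest of their levels serves them all. *)
Lemma controlled_subsets Z (eta : R) : 0 < eta ->
  exists n, forall D, (D `<=` Z)%fset -> controlled n eta [set` D].
Proof.
move=> eta0;
  have [n nP] := choice (fun D : {fset Y} => T_controls [set` D] eta0).
exists (\max_(D <- fpowerset Z) n D)%N => D DZ.
by apply: controlled_mono (nP D); apply: leq_bigmax_seq; rewrite ?fpowersetE.
Qed.

(** One step of the gliding hump. A finite set violating [4 * eta] is cut along [Z]: its part inside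
    [Z] is controlled and costs at most [eta], so the part [D] outside still exceeds [3 * eta]. The
    next [Z'] absorbs [D], [Z] and all but [eta] of [xi x]. *)
Lemma controlled_step (eta : R) : 0 < eta ->
  (forall n, exists D, ~ controlled n (4 * eta) [set` D]) ->
  forall k Z, exists nxvDZ : nat * X * ell2 R Y * {fset Y} * {fset Y},
    let: (n, x, v, D, Z') := nxvDZ in
    [/\ (k <= n)%N,
        (forall D, (D `<=` Z)%fset -> controlled n eta [set` D]),
        outside n x v /\ 3 * eta * l2norm v < absC (inner (res [set` D] (xi x)) v),
        [disjoint D & Z]%fset /\ (D `|` Z `<=` Z')%fset
      & l2norm (res (~` [set` Z']) (xi x)) <= eta].
Proof.
move=> eta0 bad k Z.
have [m mP] := controlled_subsets Z eta0.
(* [m] controls all subsets of [Z], while [k] drives the levels to infinity along the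
   construction. *)
pose n := maxn k m.
have nP D : (D `<=` Z)%fset -> controlled n eta [set` D].
  by move=> /mP; apply: controlled_mono; exact: leq_maxr.
have [D0] := bad n.
move=> /existsNP[x] /existsNP[v] /not_implyP[nv /negP]; rewrite -ltNge => D0v.
have [C CP] := res_approx (xi x) eta0.
exists (n, x, v, D0 `\` Z, D0 `|` Z `|` C)%fset; split=> //.
- exact: leq_maxl.
- split=> //; have H : controlled n eta [set` (D0 `&` Z)%fset] by apply: nP;
  exact: fsubsetIr.
  have := H x v nv; have -> : res [set` (D0 `&` Z)%fset] (xi x) =
     res [set` D0] (xi x) - res [set` (D0 `\` Z)%fset] (xi x).
    apply: ell2_eqP => y; rewrite ell2BE !resE !mem_setE !inE.
    by case: (y \in D0); case: (y \in Z); rewrite /= ?subr0 ?subrr.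
  rewrite innerBl.
  set a := inner _ v in D0v *; set b := inner _ v.
  have := ler_absCD (a - b) b; rewrite subrK.
  move: D0v; move: (absC a) (absC b) (absC (a - b)) (l2norm v) => p q r t; nra.
- split; last first.
    rewrite !fsubUset fsubDset.
    apply/andP; split; apply/fsubsetP => y; rewrite !inE => ->; rewrite ?orbT//.
  by apply/fdisjointP => y; rewrite !inE => /andP[].
- apply/ltW/(le_lt_trans _ CP); apply: l2norm_res_sub; apply: subsetC => y /=.
  by rewrite !inE => ->; rewrite orbT.
Qed.

(* Gliding hump: if no single [n] works for all finite sets, disjoint finite
   sets [D k] violating control at levels [n k >= k] are chosen so far apart
   that their union violates control at every level. *)
Lemma equi_controlled (eta : R) : 0 < eta ->
  exists n, forall D, controlled n eta [set` D].
Proof.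
move=> eta0; pose e := eta / 4; have e0 : 0 < e by rewrite divr_gt0.
have -> : eta = 4 * e by rewrite /e mulrC divfK.
apply: contrapT => /forallNP bad.
have step := controlled_step e0 (fun n => (existsNP _).2 (bad n)).
have [S SP] := choice (fun kZ : nat * {fset Y} => step kZ.1 kZ.2).
(* [Z k] is the finite region used up before stage [k]; stage [k] asks for a level at least [k]. *)
pose Z := fix Z k := if k is k'.+1 then (S (k', Z k')).2 else fset0.
pose n k := (S (k, Z k)).1.1.1.1; pose x k := (S (k, Z k)).1.1.1.2.
pose v k := (S (k, Z k)).1.1.2; pose D k := (S (k, Z k)).1.2.
have SZ k : [/\ (k <= n k)%N,
        (forall D, (D `<=` Z k)%fset -> controlled (n k) e [set` D]),
        outside (n k) (x k) (v k) /\
        3 * e * l2norm (v k) < absC (inner (res [set` D k] (xi (x k))) (v k)),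
        [disjoint D k & Z k]%fset /\ (D k `|` Z k `<=` Z k.+1)%fset
      & l2norm (res (~` [set` Z k.+1]) (xi (x k))) <= e].
  have := SP (k, Z k); rewrite /n /x /v /D /=.
  by case: (S (k, Z k)) => [[[[? ?] ?] ?] ?].
have Z_mono i j : (i <= j)%N -> (Z i `<=` Z j)%fset.
  move=> /subnK <-; elim: (j - i)%N => [|d IH]; first exact: fsubset_refl.
  apply: (fsubset_trans IH); have [_ _ _ [_]] := SZ (d + i)%N.
  by rewrite fsubUset => /andP[].
pose A : set Y := [set y | exists k, y \in D k].
(* [A] is controlled at some level [m], hence also at the level [n m >= m] of stage [m], where the
   contradiction arises. *)
have [m mA] := T_controls A e0.
have [mn small [out big] [DZ DZS] tail] := SZ m.
have Am := controlled_mono mn mA out.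
pose D' := [fset y in Z m | `[< A y >]]%fset.
have D'P := small D' (fset_sub _ _) (x m) (v m) out.
(* Earlier humps lie in [Z m] and later ones avoid [Z m.+1], so between the two regions [A] consists
   of [D m] alone. *)
have AE : res A (xi (x m)) = res [set` D'] (xi (x m)) + res [set` D m] (xi (x m))
    + res (A `&` ~` [set` Z m.+1]) (xi (x m)).
  apply: ell2_eqP => y; rewrite !ell2DE !resE in_setI in_setC !mem_setE !inE /=.
  have -> : (y \in A) = `[< A y >] by apply/idP/asboolP; rewrite in_setE.
  have DmA : y \in D m -> A y by exists m.
  have DmZ : y \in D m -> y \notin Z m by move=> yD; exact: (fdisjointP DZ).
  have DmZS : y \in D m -> y \in Z m.+1.
    by move=> yD; apply: (fsubsetP DZS); rewrite inE yD.
  have ZZS : y \in Z m -> y \in Z m.+1 by apply/fsubsetP/Z_mono.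
  have AZ : A y -> y \in Z m.+1 -> y \notin Z m -> y \in D m.
    move=> [j yDj] yZS yNZ; have [jm|mj|<-//] := ltngtP j m.
      have [_ _ _ [_ /fsubsetP Dj]] := SZ j.
      move: yNZ; rewrite (fsubsetP (Z_mono _ _ jm))// Dj// inE yDj//.
    have [_ _ _ [/fdisjointP/(_ _ yDj) yNZj _]] := SZ j.
    by move: yNZj; rewrite (fsubsetP (Z_mono _ _ mj)).
  case: asboolP => Ay; last first.
    by rewrite andbF; case: (boolP (y \in D m)) => [/DmA|]//; rewrite !addr0.
  rewrite andbT.
  case: (boolP (y \in Z m)) => yZ.
    rewrite ZZS//; case: (boolP (y \in D m)) => yD /=; last by rewrite !addr0.
    by have := DmZ yD; rewrite yZ.
  case: (boolP (y \in Z m.+1)) => yZS /=.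
    by rewrite AZ// add0r addr0.
  case: (boolP (y \in D m)) => [/DmZS|_]; first by rewrite (negPf yZS).
  by rewrite !add0r.
have tl : absC (inner (res (A `&` ~` [set` Z m.+1]) (xi (x m))) (v m)) <= e * l2norm (v m).
  apply: le_trans (cauchy_schwarz _ _) _; rewrite ler_wpM2r ?l2norm_ge0//.
  by apply: le_trans tail; apply: l2norm_res_sub => y [].
move: Am; rewrite AE !innerDl; move: D'P tl big.
set a := inner _ _; set b := inner _ _; set c := inner _ _ => ha hb hc habc.
(* The whole, the part in [Z m] and the tail are each at most [e * l2norm (v m)], which leaves at
   most three times that for the hump [c]. *)
have := ler_absCD (a + c + b) (- (a + b)); rewrite absCN.
have -> : a + c + b - (a + b) = c by ring.
have := ler_absCD a b; move: ha hb hc habc.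
move: (absC a) (absC b) (absC c) (absC _) (absC _) (l2norm _) => p q r s t l.
lra.
Qed.

Hypothesis T_fin : forall n, exists N, forall x, exists2 s : {fset X},
  (#|` s| <= N)%N & forall w, w \in s = (T n (x, w)) :> Prop.

Lemma inner_delta_xi y w : absC (inner (delta R y) (xi w)) = absC (xi w y).
Proof. by rewrite delta_inner absC_conj. Qed.

(** The constants: for a signed truncation [h] of [xi x] with small projection [P h], the vector
    [v = h - P h] satisfies |v|^2 >= 3/4 - 1/4. But [h] is a difference of two restrictions of
    [xi x] to finite sets, each controlled with 1/8, so |v|^2 = |<h, v>| <= |v| / 4, which is
    impossible. *)
Lemma large_coordinate : exists2 d : R, 0 < d & forall x, exists y, d <= absC (xi x y).
Proof.
pose eta : R := 8^-1; have eta0 : 0 < eta by rewrite invr_gt0.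
have [n nP] := equi_controlled eta0.
have [N NP] := T_fin n.
have M0 : 0 < 4 * N%:R + 4 :> R by rewrite ltr_wpDl// mulr_ge0.
(* Chosen so that d^2 N <= 1/4; the added 4 keeps the denominator positive when [N] is 0. *)
pose d := Num.sqrt (4 * N%:R + 4)^-1 : R.
have d0 : 0 < d by rewrite sqrtr_gt0 invr_gt0.
have dE : d ^+ 2 = (4 * N%:R + 4)^-1 by rewrite sqr_sqrtr// invr_ge0 ltW.
exists d => // x; apply: contrapT => /forallNP small.
have xsmall y : absC (xi x y) ^+ 2 <= d ^+ 2.
  have /negP := small y; rewrite -ltNge => h.
  by rewrite ler_pXn2r ?nnegrE ?absC_ge0 ?(ltW d0)// ltW.
have [s sN sP] := NP x.
have half0 : 0 < 2^-1 :> R by rewrite invr_gt0.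
have [C CP] := res_approx (xi x) half0.
pose P := span_proj xi s.
have [t tP] := sign_choice (fun y => P (xi x y *: delta R y)) (fset_uniq C).
pose h := \sum_(y <- C) (-1) ^+ t y *: (xi x y *: delta R y).
have Ph : l2norm (P h) ^+ 2 <= 4^-1.
  have -> : P h = \sum_(y <- C) (-1) ^+ t y *: P (xi x y *: delta R y).
    by rewrite /P span_proj_sum; apply: eq_bigr => y _; rewrite span_projZ.
  apply: le_trans tP _.
  (* The squared norm of [P (delta R y)] is the sum of |xi_w(y)|^2 over w in [s]. Summed over y
     first, each of the at most [N] unit vectors [xi w] contributes at most 1. *)
  apply: (@le_trans _ _ (d ^+ 2 * \sum_(y <- C) \sum_(w <- s) absC (xi w y) ^+ 2)).
    rewrite mulr_sumr; apply: ler_sum => y _.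
    rewrite /P span_projZ l2normZ exprMn (l2norm_span_proj xi_on).
    under eq_bigr do rewrite inner_delta_xi.
    by rewrite ler_wpM2r// sumr_ge0// => w _; exact: sqr_ge0.
  rewrite exchange_big /= dE ler_pdivrMl//.
  apply: (@le_trans _ _ N%:R); last by lra.
  apply: (@le_trans _ _ (\sum_(w <- s) 1)).
    apply: ler_sum => w _; apply: le_trans (l2norm_fset _ _) _.
    by rewrite (l2norm_xi xi_on) expr1n.
  by rewrite big_const_seq count_predT iter_addr_0 ler_nat.
(* Signs do not change the norm, and the discarded tail of the unit vector [xi x] has norm below
   1/2. *)
have hC : 3 / 4 <= l2norm h ^+ 2.
  have -> : l2norm h ^+ 2 = l2norm (res [set` C] (xi x)) ^+ 2.
    rewrite l2norm_res_fset /h.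
    under eq_bigr do rewrite scalerA.
    rewrite l2norm_sum_delta; apply: eq_bigr => y _.
    by rewrite absCM; case: (t y); rewrite /= ?expr1 ?expr0 ?absCN absC1 mul1r.
  have := l2norm_res_split [set` C] (xi x); rewrite (l2norm_xi xi_on) expr1n.
  have := l2norm_ge0 (res (~` [set` C]) (xi x)).
  move: (l2norm _) CP (_ ^+ 2) => p hp q; nra.
pose v := h - P h.
have hout : outside n x v.
  by move=> w Tw; rewrite /v span_proj_perp// sP.
have hE : h = res [set` [fset y in C | ~~ t y]%fset] (xi x) - res [set` [fset y in C | t y]%fset] (xi x).
  apply: ell2_eqP => y; rewrite /h.
  under eq_bigr do rewrite scalerA.
  rewrite sum_deltaE ell2BE !resE !mem_setE !inE /=.
  by case: (y \in C); case: (t y); rewrite /= ?subr0 ?sub0r ?mulN1r ?mul1r.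
have hv : absC (inner h v) = l2norm v ^+ 2.
  have -> : inner h v = inner v v.
    have hvP : h = v + P h by rewrite subrK.
    by rewrite {1}hvP innerDl [inner (P h) v]innerC inner_span_proj_perp// conjC0 addr0.
  by rewrite inner_self absC_real ger0_norm// sqr_ge0.
have := ler_absCD (inner (res [set` [fset y in C | ~~ t y]%fset] (xi x)) v)
   (- inner (res [set` [fset y in C | t y]%fset] (xi x)) v).
rewrite -innerBl -hE hv absCN.
have := span_proj_pythagoras xi_on s h; rewrite -/P -/v.
have := nP [fset y in C | ~~ t y]%fset x v hout.
have := nP [fset y in C | t y]%fset x v hout.
have := l2norm_ge0 v; rewrite /eta.
move: (l2norm v) (absC _) (absC _) (l2norm (P h) ^+ 2) (l2norm h ^+ 2) Ph hC => r p q a b.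
nra.
Qed.

(** On the singleton of y, [xi x] restricts to a multiple of [delta R y] by a scalar of modulus at
    least [d]. Testing control with [d * e] against the component v of [delta R y] orthogonal to the
    span gives d |v|^2 <= d e |v|. *)
Lemma coordinate_concentrated (d e : R) : 0 < d -> 0 < e -> exists n, forall x y s,
  (forall w, w \in s = T n (x, w) :> Prop) -> d <= absC (xi x y) ->
  l2norm (delta R y - span_proj xi s (delta R y)) <= e.
Proof.
move=> d0 e0; have [n nP] := equi_controlled (mulr_gt0 d0 e0).
exists n => x y s sP dxy; set v := _ - _.
have out : outside n x v by move=> w Tw; rewrite /v span_proj_perp// sP.
have := nP [fset y]%fset x v out.
rewrite set_fset1 res1 innerZl absCM.
have -> : inner (delta R y) v = inner v v.
  have yE : delta R y = v + span_proj xi s (delta R y) by rewrite subrK.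
  by rewrite {1}yE innerDl [inner (span_proj _ _ _) v]innerC inner_span_proj_perp// conjC0 addr0.
rewrite inner_self absC_real ger0_norm ?sqr_ge0//.
have := l2norm_ge0 v; move: (l2norm v) (absC _) dxy => r p dp r0.
case: (leP r e) => // er h.
have r1 : 0 < r by exact: lt_trans er.
have : p * r <= d * e.
  by rewrite -(ler_pM2r r1) -mulrA -expr2.
nra.
Qed.

End EquiApproximability.

(** * Band operators and uniform Roe algebras *)

Section FiniteCardinals.
Variable T : choiceType.
Implicit Types (A : set T) (s : {fset T}) (n : nat).

Lemma card_le_fsetP A n : (A #<= `I_n) <->
  exists2 s : {fset T}, (#|` s| <= n)%N & forall w, w \in s = A w :> Prop.
Proof.
split=> [An|[s sn sA]].
  have finA : finite_set A by apply/finite_set_leP; exists n.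
  exists (fset_set A); first exact: geq_card_fset_set.
  by move=> w; rewrite in_fset_set// in_setE.
have -> : A = [set` s] by apply/seteqP; split=> w /=; rewrite sA.
by rewrite (card_le_eql (introT card_eq_fsetP (erefl #|` s|))) card_le_II.
Qed.

Lemma card_le_bounded A n :
  (forall s : {fset T}, [set` s] `<=` A -> (#|` s| <= n)%N) -> A #<= `I_n.
Proof.
move=> An; apply/card_le_fsetP.
have finA : finite_set A.
  apply: contrapT => /(infinite_set_fset n.+1)[s /An sn].
  by rewrite ltnNge sn.
exists (fset_set A); last by move=> w; rewrite in_fset_set// in_setE.
by apply: An; rewrite fset_setK.
Qed.

(* A maximal independent set meets every conflict neighbourhood of its
   complement, so removing it lowers the degree bound. *)
Lemma independent_cover (C : T -> T -> Prop) (Q : set T -> Prop) n (U : set T) :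
  (forall p q, C p q -> C q p) ->
  (forall A B, Q A -> Q B -> Q (A `|` B)) ->
  (forall A, A `<=` U -> (forall p q, A p -> A q -> C p q -> p = q) -> Q A) ->
  (forall p, U p -> exists2 s : {fset T}, (#|` s| <= n)%N &
     forall q, U q -> C p q -> q != p -> q \in s) ->
  Q U.
Proof.
move=> Csym QU; elim: n U => [|n IH] U Qindep deg.
  apply: Qindep => // p q Up Uq Cpq; have [s s0 sP] := deg p Up.
  apply: contrapT => pq; have : q \in s.
    by apply: sP => //; apply/eqP => /esym.
  by move: s0; rewrite leqn0 cardfs_eq0 => /eqP->; rewrite inE.
pose indep A := A `<=` U /\ forall p q, A p -> A q -> C p q -> p = q.
have [|I [[IU Iindep] Imax]] := @Zorn_bigcup T indep.
  move=> G Gindep Gtot; split=> [p [A /Gindep[AU _]]|p q [A GA Ap] [B GB Bq]].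
    exact: AU.
  have [AB|BA] := Gtot _ _ GA GB.
    by apply: (Gindep _ GB).2 => //; exact: AB.
  by apply: (Gindep _ GA).2 => //; exact: BA.
have -> : U = I `|` (U `\` I) by rewrite setDUK.
apply: QU; first exact: Qindep.
apply: IH => [A AU|p [Up Ip]].
  by apply: Qindep => p /AU[].
have [s sn sP] := deg p Up.
(* By maximality, a point [p] outside [I] conflicts with some point of [I]: otherwise [p] could be
   added to [I]. *)
have [q Iq /andP[qp Cpq]] : exists2 q, I q & (q != p) && `[< C p q >].
  apply: contrapT => /forall2NP noq.
  have := Imax (I `|` [set p]); apply; first split.
  - by move=> q; left.
  - by move=> /(_ p (or_intror erefl)); exact: Ip.
  - split=> [q [/IU//|->//]|a b]; rewrite /setU /=.
    have noq' a' : I a' -> C p a' -> p = a'.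
      move=> Ia Cpa; have [//|/negP] := noq a'.
      by rewrite negb_and => /orP[/negPn/eqP->//|/negP]; case; apply/asboolP.
    case=> [Ia|->]; case=> [Ib|->]// Cab; first exact: Iindep.
      by apply/esym/noq' => //; exact: Csym.
    exact: noq'.
(* Since [q] lies in [I], it is no longer a competitor inside the complement, and the degree drops
   by one. *)
exists (s `\ q)%fset.
  have qs : q \in s by apply: sP => //; [exact: IU|exact/asboolP].
  by move: sn; rewrite (cardfsD1 q s) qs.
move=> r [Ur Ir] Cpr rp; rewrite !inE sP// andbT.
by apply/eqP => rq; apply: Ir; rewrite rq.
Qed.

End FiniteCardinals.

(** * Norm closures of star-subalgebras *)

Section ClosureAlgebra.
Variables (R : realType) (Y : choiceType).
Local Notation op := (operator R Y).
Implicit Types (a b : op) (S : set op).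

Lemma norm_closure_sub S : norm_closure S `<=` @bounded_op R Y.
Proof. by move=> a []. Qed.

Lemma cstar_norm_closure S : star_subalgebra S -> cstar_algebra (norm_closure S).
Proof.
move=> [Sb S0 SDZ SM Sadj]; split; first split.
- exact: norm_closure_sub.
- exact: sub_norm_closure.
- move=> c a b [ba aS] [bb bS]; split; first exact: bounded_opDZ.
  move=> e e0; have c0 : 0 < absC c + 1 by rewrite ltr_wpDl ?absC_ge0.
  have [a' Sa' ha] := aS _ (divr_gt0 (divr_gt0 e0 (ltr0n _ 2)) c0).
  have [b' Sb' hb] := bS _ (divr_gt0 e0 (ltr0n _ 2)).
  exists (c *: a' + b'); first exact: SDZ.
  have -> : c *: a + b - (c *: a' + b') = c *: (a - a') + (b - b').
    by rewrite scalerBr opprD addrACA.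
  apply: le_lt_trans (opnormDZ _ _ _) _; [exact/bounded_opB/Sb..|].
  rewrite [e]splitr ler_ltD//; move: ha; rewrite ltr_pdivlMr// => /ltW.
  by apply: le_trans; rewrite mulrC ler_wpM2l ?lerDl// opnorm_ge0//;
    exact/bounded_opB/Sb.
- move=> a b [ba aS] [bb bS]; split; first exact: bounded_op_comp.
  move=> e e0; have b0 : 0 < opnorm b + 1 by rewrite ltr_wpDl ?opnorm_ge0.
  have [a' Sa' ha] := aS _ (divr_gt0 (divr_gt0 e0 (ltr0n _ 2)) b0).
  have ba' := Sb _ Sa'.
  (* [b'] is chosen after [a'], because the error a' (b - b') is measured against the norm of
     [a']. *)
  have a0 : 0 < opnorm a' + 1 by rewrite ltr_wpDl ?opnorm_ge0.
  have [b' Sb' hb] := bS _ (divr_gt0 (divr_gt0 e0 (ltr0n _ 2)) a0).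
  have bb' := Sb _ Sb'; have baa := bounded_opB ba ba';
    have bbb := bounded_opB bb bb'.
  exists (a' \o b'); first exact: SM.
  have -> : (a \o b) - (a' \o b') = ((a - a') \o b) + (a' \o (b - b')).
    by apply/funext => u; rewrite /= !opE /= !opE (bopB ba') addrA subrK.
  apply: le_lt_trans (opnormD _ _) _; [exact: bounded_op_comp..|].
  rewrite [e]splitr ler_ltD//.
    apply: le_trans (opnorm_comp baa bb) _; move: ha;
      rewrite ltr_pdivlMr// => /ltW.
    by apply: le_trans; rewrite ler_wpM2l ?lerDl// opnorm_ge0.
  apply: le_lt_trans (opnorm_comp ba' bbb) _; move: hb; rewrite ltr_pdivlMr//.
  by apply: le_lt_trans; rewrite mulrC ler_wpM2l ?lerDl// opnorm_ge0.
- move=> a [ba aS]; split; first exact: bounded_op_adj.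
  move=> e /aS[a' Sa' ha]; exists (adj a'); first exact: Sadj.
  rewrite -adjB//; last exact: Sb.
  by apply: le_lt_trans (opnorm_adj _) ha; apply: bounded_opB => //; exact: Sb.
- move=> a [ba aS]; split=> // e e0.
  have [a' [ba' a'S] ha] := aS _ (divr_gt0 e0 (ltr0n _ 2)).
  have [b Sb' hb] := a'S _ (divr_gt0 e0 (ltr0n _ 2)).
  exists b => //; have -> : a - b = (a - a') + (a' - b) by rewrite addrA subrK.
  have bb := Sb _ Sb'.
  apply: le_lt_trans (opnormD _ _) _; [exact: bounded_opB..|].
  by rewrite [e]splitr ltrD.
Qed.

End ClosureAlgebra.

(** * Operators with controlled matrix with respect to an orthonormal basis *)

Section BandOperators.
Variables (R : realType) (X Y : choiceType) (xi : X -> ell2 R Y).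
Hypothesis xi_on : forall x z, inner (xi x) (xi z) = (x == z)%:R.
Hypothesis xi_total : forall v, (forall w, inner v (xi w) = 0) -> v = 0.
Local Notation op := (operator R Y).
Implicit Types (a b : op).

Definition matrix_supp a : set (X * X) :=
  [set p | inner (a (xi p.2)) (xi p.1) != 0].

(** For [xi] the canonical basis this is the algebra whose closure is the uniform Roe algebra; the
    Cartan case uses the basis of the range vectors of the [Phi (chi x)]. *)
Definition band (K : set (set (X * X))) : set op :=
  [set a | bounded_op a /\ K (matrix_supp a)].

(** Totality avoids infinite expansions: the difference of the two sides has all coefficients
    zero. *)
Lemma span_proj_total u (s : {fset X}) :
  (forall w, inner u (xi w) != 0 -> w \in s) -> u = span_proj xi s u.
Proof.
move=> us; apply/eqP; rewrite -subr_eq0; apply/eqP/xi_total => w.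
have [ws|ws] := boolP (w \in s); first exact: span_proj_perp.
rewrite innerBl span_proj_inner// (negPf ws) subr0.
by apply/eqP; apply: contraNT ws => /us.
Qed.

Lemma star_subalgebra_band (K : set (set (X * X))) :
  coarse_structure K -> uniformly_locally_finite K -> star_subalgebra (band K).
Proof.
move=> [Kd Ksub KU Kinv Kcomp] Kulf; split.
- by move=> a [].
- split; first exact: bounded_op0.
  by apply: Ksub Kd => p /=; rewrite /matrix_supp/= op0E inner0l eqxx.
- move=> c a b [ba Ka] [bb Kb]; split; first exact: bounded_opDZ.
  apply: Ksub (KU _ _ Ka Kb) => p;
    rewrite /matrix_supp /= !opE innerDl innerZl => h.
  apply: contrapT => /not_orP[/negP/negPn/eqP pa /negP/negPn/eqP pb].
  by move: h; rewrite pa pb mulr0 addr0 eqxx.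
- move=> a b [ba Ka] [bb Kb]; split; first exact: bounded_op_comp.
  apply: Ksub (Kcomp _ _ Ka Kb) => -[x z]; rewrite /matrix_supp /=.
  (* Columns of [b] are rows of the inverse of its support, hence finite, so the entries of the
     product are finite sums. *)
  have [N /(_ z)/card_le_fsetP[s _ sP]] := Kulf _ (Kinv _ Kb).
  have bE : b (xi z) = span_proj xi s (b (xi z)).
    by apply: span_proj_total => w; rewrite sP.
  rewrite {1}bE (bop_sum ba) inner_suml => h; apply: contrapT => /forall2NP now.
  move: h; rewrite big1 ?eqxx// => w _; rewrite (bopZ ba) innerZl.
  by have [/negP/negPn/eqP->|/negP/negPn/eqP->] := now w; rewrite ?mulr0 ?mul0r.
- move=> a [ba Ka]; split; first exact: bounded_op_adj.
  apply: Ksub (Kinv _ Ka) => -[x z]; rewrite /matrix_supp /= inner_adjr//.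
  by rewrite innerC conjC_eq0.
Qed.

End BandOperators.

(** * Basic members of the uniform Roe algebra *)

Section UniformRoe.
Variables (R : realType) (X : choiceType) (E : set (set (X * X))).
Hypotheses (cE : coarse_structure E) (uE : uniformly_locally_finite E).

Lemma delta_on (x z : X) : inner (delta R x) (delta R z) = (x == z)%:R.
Proof. by rewrite inner_delta deltaE eq_sym. Qed.

Lemma delta_total (v : ell2 R X) : (forall w, inner v (delta R w) = 0) -> v = 0.
Proof. by move=> v0; apply: ell2_eqP => x; rewrite -inner_delta v0. Qed.

Lemma cstar_uniform_Roe : cstar_algebra (@uniform_Roe R X E).
Proof.
by apply/cstar_norm_closure/(star_subalgebra_band delta_on delta_total).
Qed.

Lemma sub_uniform_Roe (a : operator R X) : bounded_op a -> E (supp a) ->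
  uniform_Roe E a.
Proof. by move=> ba Ea; apply: sub_norm_closure => [b []|]. Qed.

Lemma ell_infty_uniform_Roe : @ell_infty R X `<=` uniform_Roe E.
Proof.
move=> a [ba ad]; apply: sub_uniform_Roe => //.
by case: cE => Ed Esub _ _ _; apply: Esub Ed.
Qed.

Lemma ell_infty_res (A : set X) : ell_infty (@res R X A).
Proof.
split; first exact: bounded_op_res.
move=> -[x z]; rewrite /supp /= inner_delta resE deltaE /diagonal /=.
by case: ifP => // _; case: (eqVneq x z); rewrite ?eqxx.
Qed.

End UniformRoe.

(** * Embeddings and the map on points *)

Section PartialBijection.
Variables (R : realType) (X : choiceType).

Lemma l2norm_uniq (u : ell2 R X) (s : seq X) : uniq s ->
  \sum_(x <- s) absC (u x) ^+ 2 <= l2norm u ^+ 2.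
Proof.
move=> us; apply: le_trans (l2norm_fset u [fset x in s]%fset).
rewrite (perm_big [fset x in s]%fset)//=.
by apply: uniq_perm => // x; rewrite !inE.
Qed.

(** A single-valued and injective relation gives a partial isometry, sending [delta R z] to
    [delta R x] when V (x, z). *)
Lemma partial_bijection_op (V : set (X * X)) :
  (forall x z z', V (x, z) -> V (x, z') -> z = z') ->
  (forall x x' z, V (x, z) -> V (x', z) -> x = x') ->
  exists v : operator R X, [/\ bounded_op v,
    forall u x z, V (x, z) -> v u x = u z &
    forall u x, (forall z, ~ V (x, z)) -> v u x = 0].
Proof.
move=> Vfun Vinj.
have /choice[g gP] : forall x, exists o : option X,
    if o is Some z then V (x, z) else forall z, ~ V (x, z).
  move=> x; have [[z Vxz]|/forallNP noz] := pselect (exists z, V (x, z)).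
    by exists (Some z).
  by exists None.
have gE x z : V (x, z) -> g x = Some z.
  by move=> Vxz; have := gP x; case: (g x) => [z' Vxz'|/(_ z)//];
    rewrite (Vfun _ _ _ Vxz Vxz').
pose f (u : ell2 R X) x := if g x is Some z then u z else 0.
have f_le (u : ell2 R X) (A : {fset X}) :
    \sum_(x <- A) absC (f u x) ^+ 2 <= l2norm u ^+ 2.
  (* Injectivity of [V] makes [pmap g A] free of repetitions, so the sum runs over distinct
     coordinates of [u]. *)
  apply: (@le_trans _ _ (\sum_(z <- pmap g A) absC (u z) ^+ 2)).
    rewrite big_pmap; apply: ler_sum => x _ /=; rewrite /f.
    by case: (g x) => //=; rewrite absC0 expr0n.
  apply: l2norm_uniq.
  elim: (enum_fset A) (fset_uniq A) => //= x s IH /andP[xs us].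
  case gx: (g x) => [z|] /=; last exact: IH.
  rewrite IH// andbT mem_pmap; apply/mapP => -[x' x's] gx'.
  have := gP x; have := gP x'; rewrite -gx' gx => Vx'z Vxz.
  by move: xs; rewrite (Vinj _ _ _ Vxz Vx'z) x's.
have fS u := square_summable_bound (f_le u).
exists (fun u => Ell2 (fS u)); split.
- apply: (@bounded_op_opnorm _ _ _ 1).
    move=> k u w; apply: ell2_eqP => x; rewrite ell2DE ell2ZE /= /f.
    by case: (g x) => //; rewrite mulr0 addr0.
  move=> u; rewrite mul1r -(@ler_pXn2r _ 2)// ?nnegrE ?l2norm_ge0//.
  by apply: l2norm_bound => A; exact: f_le.
- by move=> u x z Vxz /=; rewrite /f (gE _ _ Vxz).
- by move=> u x nV /=; rewrite /f; have := gP x; case: (g x) => // z /nV.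
Qed.

End PartialBijection.

(** * Images of the point projections and the map f *)

Section Embedding.
Variables (R : realType) (X Y : choiceType).
Variables (E : set (set (X * X))) (F : set (set (Y * Y))).
Variable Phi : operator R X -> operator R Y.
Hypotheses (cE : coarse_structure E) (uE : uniformly_locally_finite E).
Hypothesis Phi_emb : embedding (uniform_Roe E) (uniform_Roe F) Phi.
Local Notation Roe := (@uniform_Roe R X E).
Implicit Types (a b : operator R X) (u v : ell2 R Y) (x z : X).

Lemma Roe_star : star_subalgebra Roe.
Proof. by case: (@cstar_uniform_Roe R X E cE uE). Qed.

Lemma Roe_bounded a : Roe a -> bounded_op a.
Proof. by case: Roe_star => + _ _ _ _; apply. Qed.

Lemma Roe0 : Roe 0. Proof. by case: Roe_star. Qed.

Lemma Roe_DZ (c : R[i]) a b : Roe a -> Roe b -> Roe (c *: a + b).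
Proof. by case: Roe_star => _ _ + _ _; apply. Qed.

Lemma Roe_B a b : Roe a -> Roe b -> Roe (a - b).
Proof. by move=> ra rb; rewrite addrC -(scaleN1r b); exact: Roe_DZ. Qed.

Lemma Roe_M a b : Roe a -> Roe b -> Roe (a \o b).
Proof. by case: Roe_star => _ _ _ + _; apply. Qed.

Lemma Roe_adj a : Roe a -> Roe (adj a).
Proof. by case: Roe_star => _ _ _ _; apply. Qed.

Lemma Roe_res (A : set X) : Roe (@res R X A).
Proof. by apply: ell_infty_uniform_Roe => //; exact: ell_infty_res. Qed.

Lemma Roe_chi x : Roe (@chi R X x).
Proof. by rewrite chiE; exact: Roe_res. Qed.

Lemma Phi_Roe a : Roe a -> uniform_Roe F (Phi a).
Proof. by case: Phi_emb => + _ _ _ _; apply. Qed.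

Lemma Phi_bounded a : Roe a -> bounded_op (Phi a).
Proof. by move=> /Phi_Roe[]. Qed.

Lemma Phi_DZ (c : R[i]) a b : Roe a -> Roe b -> Phi (c *: a + b) = c *: Phi a + Phi b.
Proof. by case: Phi_emb => _ + _ _ _; apply. Qed.

Lemma Phi0 : Phi 0 = 0.
Proof.
have := Phi_DZ 1 Roe0 Roe0; rewrite !scale1r addr0 => /eqP.
by rewrite -subr_eq subrr eq_sym => /eqP.
Qed.

Lemma Phi_D a b : Roe a -> Roe b -> Phi (a + b) = Phi a + Phi b.
Proof. by move=> ra rb; have := Phi_DZ 1 ra rb; rewrite !scale1r. Qed.

Lemma Phi_Z (c : R[i]) a : Roe a -> Phi (c *: a) = c *: Phi a.
Proof. by move=> ra; have := Phi_DZ c ra Roe0; rewrite Phi0 !addr0. Qed.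

Lemma Phi_B a b : Roe a -> Roe b -> Phi (a - b) = Phi a - Phi b.
Proof.
move=> ra rb; rewrite addrC -(scaleN1r b) Phi_DZ//.
by rewrite scaleN1r addrC.
Qed.

Lemma Phi_M a b u : Roe a -> Roe b -> Phi (a \o b) u = Phi a (Phi b u).
Proof. by case: Phi_emb => _ _ + _ _ => PM ra rb; rewrite PM. Qed.

Lemma Phi_adj a : Roe a -> Phi (adj a) = adj (Phi a).
Proof. by case: Phi_emb => _ _ _ + _; apply. Qed.

Lemma Phi_inj a b : Roe a -> Roe b -> Phi a = Phi b -> a = b.
Proof. by case: Phi_emb => _ _ _ _; apply. Qed.

Lemma Phi_res_inner (A : set X) u v :
  inner (Phi (res A) u) v = inner u (Phi (res A) v).
Proof.
rewrite inner_adj; last exact/Phi_bounded/Roe_res.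
by rewrite -Phi_adj ?adj_res//; exact: Roe_res.
Qed.

Lemma Phi_res_idem (A : set X) u : Phi (res A) (Phi (res A) u) = Phi (res A) u.
Proof.
rewrite -(Phi_M _ (Roe_res A) (Roe_res A)).
by congr (Phi _ u); apply/funext => w /=; rewrite res_idem.
Qed.

(** [Phi (res A)] is a self-adjoint idempotent P, so |P u|^2 = <u, P u> <= |u| |P u|. *)
Lemma l2norm_Phi_res (A : set X) u : l2norm (Phi (res A) u) <= l2norm u.
Proof.
set q := Phi (res A) u; have [q0|q0] := eqVneq (l2norm q) 0.
  by rewrite q0 l2norm_ge0.
have qpos : 0 < l2norm q by rewrite lt_def q0 l2norm_ge0.
rewrite -(ler_pM2r qpos) -expr2.
have <- : absC (inner u q) = l2norm q ^+ 2.
  rewrite -[l2norm q ^+ 2]ger0_norm ?sqr_ge0// -absC_real -inner_self /q.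
  by rewrite Phi_res_inner Phi_res_idem.
exact: cauchy_schwarz.
Qed.

Lemma chi_compress a x : bounded_op a ->
  (chi x \o a) \o chi x = a (delta R x) x *: chi x.
Proof.
move=> ba; apply/funext => u; rewrite opZE /= !chiE !res1 (bopZ ba) ell2ZE.
by rewrite mulrC scalerA.
Qed.

(** The corner cut out by [chi x] is one-dimensional in the Roe algebra of X, and the embedding
    preserves this relation. *)
Lemma Phi_compress a x u : Roe a ->
  Phi (chi x) (Phi a (Phi (chi x) u)) = a (delta R x) x *: Phi (chi x) u.
Proof.
move=> ra; have rx := Roe_chi x.
transitivity (Phi ((chi x \o a) \o chi x) u).
  by rewrite (Phi_M _ (Roe_M rx ra) rx) (Phi_M _ rx ra).
by rewrite chi_compress ?Phi_Z//; exact: Roe_bounded.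
Qed.

Lemma Phi_chi_neq0 x : exists u, Phi (chi x) u <> 0.
Proof.
apply: contrapT => /forallNP p0.
have : Phi (chi x) = Phi 0.
  by rewrite Phi0; apply/funext => u; apply: contrapT => /p0.
move=> /(Phi_inj (Roe_chi x) Roe0) /(congr1 (fun a => a (delta R x) x)).
rewrite chiE res1 ell2ZE deltaE eqxx mulr1 => /eqP.
by rewrite oner_eq0.
Qed.

(** A nonzero projection p has some g = p delta_y that does not vanish. The hypothesis at this y
    reads c (p u) = <u, g> g, so p has rank one with range spanned by g. *)
Lemma rank_one x :
  (forall y, exists c : R[i], forall u,
     Phi (chi x) (chi y (Phi (chi x) u)) = c *: Phi (chi x) u) ->
  exists2 w : ell2 R Y, l2norm w = 1 & forall u, Phi (chi x) u = inner u w *: w.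
Proof.
set p := Phi (chi x) => compr.
have p_inner u v : inner (p u) v = inner u (p v) by rewrite /p chiE Phi_res_inner.
have p_idem u : p (p u) = p u by rewrite /p chiE Phi_res_idem.
have bp : bounded_op p by apply/Phi_bounded/Roe_chi.
have [y py] : exists y, p (delta R y) != 0.
  apply: contrapT => /forallNP py0; have [u] := Phi_chi_neq0 x; apply.
  apply: ell2_eqP => y; rewrite -inner_delta p_inner.
  by have /negP/negPn/eqP-> := py0 y; rewrite inner0r.
have [c cP] := compr y; pose g := p (delta R y); set r := l2norm g.
have r0 : r != 0 by apply: contra_neq py => /l2norm_eq0.
have gy : g y = (r ^+ 2)%:C%C.
  by rewrite -inner_delta /g -p_idem p_inner -/g inner_self.
have cu u : c *: p u = inner u g *: g.
  by rewrite -cP chiE res1 (bopZ bp) -inner_delta p_inner.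
have c0 : c != 0.
  apply/eqP => c0; have := cu (delta R y); rewrite c0 scale0r delta_inner gy.
  rewrite conjC_real_complex => /(congr1 (@l2norm _ _)).
  rewrite l2norm0 l2normZ absC_real -/r => /eqP.
  by rewrite eq_sym mulf_eq0 normr_eq0 sqrf_eq0 (negPf r0).
(* Evaluation at [g], which [p] fixes, identifies the scalar and hence the normalization of the
   range vector. *)
have cr : c = (r ^+ 2)%:C%C.
  have := cu g; rewrite {1}/g p_idem -/g inner_self -/r => /eqP.
  rewrite -subr_eq0 -scalerBl scaler_eq0 subr_eq0 => /orP[/eqP//|/eqP g0].
  by move: r0; rewrite /r g0 l2norm0 eqxx.
have rpos : 0 < r by rewrite lt_def r0 l2norm_ge0.
exists (r^-1%:C%C *: g).
  by rewrite l2normZ absC_real ger0_norm ?invr_ge0 ?l2norm_ge0// -/r mulVf.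
move=> u;
  rewrite innerZr conjC_real_complex scalerA mulrAC -scalerA -cu scalerA cr.
rewrite -!rmorphM (_ : r^-1 * r^-1 * r ^+ 2 = 1) ?rmorph1 ?scale1r//.
by field.
Qed.

Variable xi : X -> ell2 R Y.
Hypothesis xi1 : forall x, l2norm (xi x) = 1.
Hypothesis PhiE : forall x u, Phi (chi x) u = inner u (xi x) *: xi x.

Lemma Phi_chi_xi x : Phi (chi x) (xi x) = xi x.
Proof. by rewrite PhiE inner_self xi1 expr1n scale1r. Qed.

Lemma inner_Phi_chi x u : inner u (xi x) = inner (Phi (chi x) u) (xi x).
Proof. by rewrite PhiE innerZl inner_self xi1 expr1n mulr1. Qed.

Lemma xi_orthonormal x z : inner (xi x) (xi z) = (x == z)%:R.
Proof.
have [<-|xz] := eqVneq; first by rewrite inner_self xi1 expr1n.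
rewrite inner_Phi_chi -(Phi_chi_xi x) -(Phi_M _ (Roe_chi z) (Roe_chi x)).
have -> : chi z \o chi x = 0 :> operator R X.
  apply/funext => u /=; rewrite !chiE !res1 ell2ZE deltaE.
  by rewrite eq_sym (negPf xz) mulr0 scale0r.
by rewrite Phi0 inner0l.
Qed.

(** Both squared norms are the diagonal entry at x of [adj a \o a], by [Phi_compress]. This carries
    norm estimates through [Phi] on the vectors [xi x]. *)
Lemma l2norm_Phi_xi a x : Roe a -> l2norm (Phi a (xi x)) = l2norm (a (delta R x)).
Proof.
move=> ra; have ba := Roe_bounded ra.
apply/eqP; rewrite -(@eqrXn2 _ 2)// ?l2norm_ge0// !l2norm_sqrE.
rewrite inner_adj; last exact: Phi_bounded.
rewrite -(Phi_adj ra) -(Phi_M _ (Roe_adj ra) ra).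
have raa : Roe (adj a \o a) by exact: (Roe_M (Roe_adj ra) ra).
rewrite innerC inner_Phi_chi -{1}(Phi_chi_xi x) Phi_compress// Phi_chi_xi.
rewrite innerZl inner_self xi1 expr1n mulr1 -inner_delta /=.
by rewrite inner_adjr// -innerC.
Qed.

Lemma Phi_row_eq0 a w u : Roe a -> (forall t, a t w = 0) -> inner (Phi a u) (xi w) = 0.
Proof.
move=> ra aw; rewrite inner_Phi_chi -(Phi_M _ (Roe_chi w) ra).
have -> : chi w \o a = 0.
  by apply/funext => t /=; rewrite chiE res1 aw scale0r.
by rewrite Phi0 inner0l.
Qed.

Variable T : nat -> set (X * X).
Hypothesis T_mono : forall m n, (m <= n)%N -> T m `<=` T n.
Hypothesis T_refl : forall n x, T n (x, x).
Hypothesis T_controls : forall A (eta : R), 0 < eta -> exists n, controlled xi T n eta A.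
Hypothesis T_row : forall n, exists N, forall x, exists2 s : {fset X},
  (#|` s| <= N)%N & forall w, w \in s = (T n (x, w)) :> Prop.
Hypothesis T_col : forall n, exists N, forall x, exists2 s : {fset X},
  (#|` s| <= N)%N & forall w, w \in s = (T n (w, x)) :> Prop.

Lemma cardfsU_le (K : choiceType) (s t : {fset K}) :
  (#|` (s `|` t)%fset| <= #|` s| + #|` t|)%N.
Proof. by rewrite cardfsU leq_subr. Qed.

Lemma fset_bigcup_le (I K : choiceType) (s : seq I) (G : I -> {fset K}) M :
  (forall i, (#|` G i| <= M)%N) -> exists2 t : {fset K},
    (#|` t| <= size s * M)%N & forall i, i \in s -> (G i `<=` t)%fset.
Proof.
move=> GM; elim: s => [|i s [t tM tG]]; first by exists fset0; rewrite ?cardfs0.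
exists (G i `|` t)%fset.
  by apply: leq_trans (cardfsU_le _ _) _; rewrite mulSn leq_add.
move=> j; rewrite inE => /orP[/eqP->|/tG jt]; first exact: fsubsetUl.
exact: fsubset_trans jt (fsubsetUr _ _).
Qed.

(** For V (x, z), the inner product of [Phi v (delta R (f z))] with the projection of
    [delta R (f x)] reduces to its x-term, of modulus at least d^2. Replacing the projection by
    [delta R (f x)] and [Phi v] by a nearby [b] costs d^2/4 each, so [b] has a nonzero entry at (f
    x, f z). *)
Lemma separated_image n (f : X -> Y) (d : R) (V : set (X * X)) :
  0 < d -> (forall x, d <= absC (xi x (f x))) ->
  (forall x s, (forall w, w \in s = T n (x, w) :> Prop) ->
    l2norm (delta R (f x) - span_proj xi s (delta R (f x))) <= d ^+ 2 / 4) ->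
  E V ->
  (forall p q, V p -> V q -> T n (p.1, q.1) \/ T n (q.1, p.1) \/ p.2 = q.2 -> p = q) ->
  coarse_structure F ->
  F [set (f p.1, f p.2) | p in V].
Proof.
move=> d0 fd conc EV Vsep [_ Fsub _ _ _].
(* Two pairs with the same first point conflict because [T n] is reflexive. *)
have Vfun x z z' : V (x, z) -> V (x, z') -> z = z'.
  by move=> h h'; have [] := Vsep _ _ h h' (or_introl (T_refl n x)).
have Vinj x x' z : V (x, z) -> V (x', z) -> x = x'.
  by move=> h h'; have [] := Vsep _ _ h h' (or_intror (or_intror erefl)).
have [v [bv vV v0]] := @partial_bijection_op R X V Vfun Vinj.
have vdelta x z : V (x, z) -> v (delta R z) = delta R x.
  move=> Vxz; apply: ell2_eqP => x'; rewrite deltaE.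
  have [[z' V']|/forallNP nV] := pselect (exists z', V (x', z')).
    rewrite (vV _ _ _ V') deltaE; congr (nat_of_bool _)%:R.
    apply/eqP/eqP => [zz|xx]; first by rewrite zz in V'; exact: Vinj V' Vxz.
    by rewrite xx in V'; exact: Vfun V' Vxz.
  rewrite v0//; case: eqP => // xx; case: (nV z); by rewrite xx.
have vdelta0 z : (forall x, ~ V (x, z)) -> v (delta R z) = 0.
  move=> nV; apply: ell2_eqP => x'; rewrite ell2_0E.
  have [[z' V']|/forallNP nV'] := pselect (exists z', V (x', z'));
    last exact: v0.
  by rewrite (vV _ _ _ V') deltaE; case: eqP => // zz; case: (nV x');
    rewrite -zz.
have rv : Roe v.
  apply: sub_uniform_Roe => //; case: cE => _ Esub _ _ _; apply: Esub EV.
  move=> [x z]; rewrite /supp /= inner_delta => vxz.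
  have [[z' V']|/forallNP nV'] := pselect (exists z', V (x, z')).
    move: vxz; rewrite (vV _ _ _ V') deltaE; case: (eqVneq z' z) => [<-//|_].
    by rewrite mulr0n eqxx.
  by move: vxz; rewrite (v0 _ _ nV') eqxx.
have vv : adj v \o v = res [set z | exists x, V (x, z)].
  apply: op_ext_delta;
    [exact/bounded_op_comp/bv/bounded_op_adj|exact: bounded_op_res|].
  move=> x z; transitivity (inner (adj v (v (delta R z))) (delta R x)).
    by rewrite inner_delta.
  rewrite inner_adjr// resE.
  have [[x' V']|/forallNP nV] := pselect (exists x', V (x', z)).
    rewrite (vdelta _ _ V') delta_inner (vV _ _ _ V').
    rewrite conjC_nat; case: ifPn => [_|/negP xV];
      first by rewrite ?deltaE eq_sym.
    by rewrite ?deltaE; case: eqP => // zx; case: xV; rewrite in_setE /= -zx;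
      exists x'.
  rewrite vdelta0// inner0l; case: ifPn => // /set_mem [x' V'].
  by rewrite deltaE; case: eqP => // xz; case: (nV x'); rewrite -xz.
(* [adj v \o v] is a diagonal projection, whose image is a contraction. *)
have v_le u : l2norm (Phi v u) <= l2norm u.
  rewrite -(@ler_pXn2r _ 2)// ?nnegrE ?l2norm_ge0//.
  rewrite -[leLHS]ger0_norm ?sqr_ge0// -absC_real -inner_self.
  rewrite inner_adj; last exact: Phi_bounded.
  rewrite -(Phi_adj rv) -(Phi_M _ (Roe_adj rv) rv).
  rewrite vv; apply: le_trans (cauchy_schwarz _ _) _.
  by rewrite expr2 ler_wpM2l ?l2norm_ge0// l2norm_Phi_res.
have [b [bb Fb] hb] : exists2 b, bounded_op b /\ F (supp b) & opnorm (Phi v - b) < d ^+ 2 / 4.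
  by have [_] := Phi_Roe rv; apply; rewrite divr_gt0// exprn_gt0.
apply: Fsub Fb => _ [[x z] /= Vxz <-]; rewrite /supp /=; apply/eqP => b0.
have [N /(_ x)[s _ sP]] := T_row n.
set y := f x in b0 *; set y' := f z in b0 *.
pose P := span_proj xi s (delta R y).
(* A term with w different from x vanishes: if w were a first point of [V], then T n (x, w) would
   contradict separation. *)
have main : inner (Phi v (delta R y')) P =
    (inner (delta R y) (xi x))^* * (inner (delta R y') (xi z) * inner (Phi v (xi z)) (xi x)).
  rewrite inner_sumr (big_fsetD1 x)/=; last by rewrite sP.
  rewrite big_seq big1 ?addr0 => [|w]; last first.
    rewrite !inE => /andP[wx ws]; rewrite innerZr Phi_row_eq0 ?mulr0// => t.
    apply: v0 => z' Vwz'; move: wx; rewrite sP in ws.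
    by have [->] := Vsep _ _ Vwz' Vxz (or_intror (or_introl ws)); rewrite eqxx.
  rewrite innerZr; congr (_ * _).
  rewrite inner_Phi_chi -(Phi_M _ (Roe_chi x) rv).
  have -> : chi x \o v = v \o chi z.
    apply/funext => u /=; rewrite !chiE !res1 (bopZ bv) (vdelta _ _ Vxz).
    by rewrite (vV _ _ _ Vxz).
  by rewrite (Phi_M _ rv (Roe_chi z)) (PhiE z) (bopZ (Phi_bounded rv)) innerZl.
(* [Phi v (xi z)] is a multiple of [xi x], and its norm is that of [v (delta R z) = delta R x]. *)
have one : absC (inner (Phi v (xi z)) (xi x)) = 1.
  have : Phi v (xi z) = inner (Phi v (xi z)) (xi x) *: xi x.
    rewrite -(PhiE x) -(Phi_M _ (Roe_chi x) rv).
    have -> : chi x \o v = v \o chi z.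
      apply/funext => u /=; rewrite !chiE !res1 (bopZ bv) (vdelta _ _ Vxz).
      by rewrite (vV _ _ _ Vxz).
    by rewrite (Phi_M _ rv (Roe_chi z)) Phi_chi_xi.
  move=> /(congr1 (@l2norm _ _)); rewrite l2normZ xi1 mulr1 => <-.
  by rewrite l2norm_Phi_xi// (vdelta _ _ Vxz) l2norm_delta.
have : d ^+ 2 <= absC (inner (Phi v (delta R y')) P).
  rewrite main !absCM one mulr1 absC_conj !delta_inner !absC_conj expr2.
  by rewrite ler_pM// ?ltW.
rewrite leNgt => /negP; apply.
have -> : P = delta R y - (delta R y - P) by rewrite opprB addrC subrK.
rewrite innerBr; apply: le_lt_trans (ler_absCD _ _) _; rewrite absCN.
have -> : inner (Phi v (delta R y')) (delta R y) = inner ((Phi v - b) (delta R y')) (delta R y).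
  by rewrite !opE innerDl innerNl b0 subr0.
have h1 : absC (inner ((Phi v - b) (delta R y')) (delta R y)) <= d ^+ 2 / 4.
  apply: le_trans (cauchy_schwarz _ _) _; rewrite l2norm_delta mulr1.
  apply: le_trans (l2norm_bop _ _) _; first exact/bounded_opB/bb/Phi_bounded.
  by rewrite l2norm_delta mulr1 ltW.
have h2 : absC (inner (Phi v (delta R y')) (delta R y - P)) <= d ^+ 2 / 4.
  apply: le_trans (cauchy_schwarz _ _) _.
  apply: le_trans (conc x s sP); rewrite ler_piMl ?l2norm_ge0//.
  by apply: le_trans (v_le _) _; rewrite l2norm_delta.
have := exprn_gt0 2 d0; move: h1 h2; move: (absC _) (absC _) (d ^+ 2) => p q r.
lra.
Qed.

Lemma embedding_map : coarse_structure F -> exists f : X -> Y,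
  [/\ coarse_map E F f, uniformly_finite_to_one f
    & (0 < ereal_inf
             [set (l2norm (Phi (chi x) (delta R (f x))))%:E | x in setT])%E].
Proof.
move=> cF; have on := xi_orthonormal.
have [d d0 /choice[f fd]] := large_coordinate on T_mono T_controls T_row.
exists f; split.
- move=> U EU; exists [set (f p.1, f p.2) | p in U]; last by move=> x z Uxz;
  exists (x, z).
  have d4 : 0 < d ^+ 2 / 4 by rewrite divr_gt0// exprn_gt0.
  have [n nP] := coordinate_concentrated on T_mono T_controls d0 d4.
  have [Nr NrP] := T_row n; have [Nc NcP] := T_col n.
  have [M MP] := uE EU.
  have [M' M'P] : exists M', forall x, [set z | (U^-1)%relation (x, z)] #<= `I_M'.
    by apply: uE; case: cE => _ _ _ Einv _; exact: Einv.
  have /choice[r rP] : forall x, exists s : {fset X},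
      (#|` s| <= M)%N /\ forall w, w \in s = U (x, w) :> Prop.
    by move=> x; have [s ? ?] := (card_le_fsetP _ _).1 (MP x); exists s.
  pose C (p q : X * X) := T n (p.1, q.1) \/ T n (q.1, p.1) \/ p.2 = q.2.
  have [_ Fsub FU _ _] := cF.
  (* The degree bound counts pairs (a, b) conflicting with (x, z): at most [Nr + Nc] values of a
     related to x by [T n], each with at most [M] values of b, and at most [M'] pairs with b = z. *)
  apply: (@independent_cover _ C (fun V => F [set (f p.1, f p.2) | p in V]) ((Nr + Nc) * M + M')%N).
  + by move=> p q [h|[h|h]]; [right; left|left|right; right].
  + move=> A B FA FB; apply: Fsub (FU _ _ FA FB).
    by move=> _ [p [Ap|Bp] <-]; [left|right]; exists p.
  + move=> V VU Vind; apply: (separated_image d0 fd) => //.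
      by move=> x s sP; apply: nP.
      by case: cE => _ Esub _ _ _; exact: Esub EU.
    exact: Vind.
  + move=> [x z] Uxz; have [s1 s1N s1P] := NrP x; have [s2 s2N s2P] := NcP x.
    have [s3 s3M s3P] := (card_le_fsetP _ _).1 (M'P z).
    have GM (a : X) : (#|` [fset (a, b) | b in r a]%fset| <= M)%N.
      by apply: leq_trans (leq_imfset_card _ _ _) _; rewrite //=;
        have [] := rP a.
    have [t tM tP] := fset_bigcup_le (enum_fset (s1 `|` s2)%fset) GM.
    pose t' := [fset (a, z) | a in s3]%fset.
    exists (t `|` t')%fset.
      apply: leq_trans (cardfsU_le _ _) _; apply: leq_add.
        apply: leq_trans tM _; rewrite leq_mul2r; apply/orP; right.
        by apply: leq_trans (cardfsU_le _ _) _; exact: leq_add.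
      by apply: leq_trans (leq_imfset_card _ _ _) _.
    move=> [a b] Uab Cab _; rewrite inE.
    have rab : b \in r a by have [_ ->] := rP a.
    have inG : (a, b) \in [fset (a, b) | b in r a]%fset by apply/imfsetP;
      exists b.
    case: Cab => /= [Tn|[Tn|zb]]; apply/orP.
    * left; apply: (fsubsetP (tP a _)) inG; have as1 : a \in s1 by rewrite s1P.
      by rewrite inE as1.
    * left; apply: (fsubsetP (tP a _)) inG; have as2 : a \in s2 by rewrite s2P.
      by rewrite inE as2 orbT.
    * by right; apply/imfsetP; exists a => //=; rewrite ?s3P zb.
(* Each point of the fibre over y contributes at least d^2 to the Bessel sum of the unit vector
   [delta R y]. *)
- have [n nP] : exists n : nat, (d ^+ 2)^-1 <= n%:R.
    by exists (Num.truncn (d ^+ 2)^-1).+1; apply/ltW; rewrite truncnS_gt.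
  exists n => y _; apply: card_le_bounded => s sy.
  rewrite -(ler_nat R); apply: le_trans nP.
  rewrite -[leRHS]mul1r ler_pdivlMr ?exprn_gt0//.
  apply: (@le_trans _ _ (\sum_(x <- s) absC (inner (delta R y) (xi x)) ^+ 2)).
    have -> : #|` s|%:R * d ^+ 2 = \sum_(x <- s) d ^+ 2.
      by rewrite big_const_seq count_predT iter_addr_0 mulr_natl.
    rewrite big_seq [leRHS]big_seq; apply: ler_sum => x xs.
    have /= fxy := sy x xs.
    by rewrite delta_inner absC_conj -fxy ler_pXn2r ?nnegrE ?absC_ge0 ?(ltW d0).
  by apply: le_trans (bessel on _ _) _; rewrite l2norm_delta expr1n.
- apply: (@lt_le_trans _ _ d%:E); first by rewrite lte_fin.
  apply: le_ereal_inf_tmp => _ [x _ <-].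
  by rewrite lee_fin PhiE l2normZ xi1 mulr1 delta_inner absC_conj fd.
Qed.

End Embedding.

(** * The range contains the diagonal operators *)

Section DiagonalOperators.
Variables (R : realType) (X : choiceType).
Implicit Types (b : operator R X).

Lemma ell_infty_apply b u x : ell_infty b -> b u x = b (delta R x) x * u x.
Proof.
move=> [bb bd]; rewrite -inner_delta inner_adj//.
have -> : adj b (delta R x) = (b (delta R x) x)^* *: delta R x.
  apply: ell2_eqP => z;
    rewrite -inner_delta inner_adjr// delta_inner ell2ZE deltaE.
  have [->|zx] := eqVneq z x; first by rewrite mulr1.
  rewrite mulr0; apply/eqP; rewrite conjC_eq0; apply: contraTT zx => bzx.
  have /bd/= : supp b (x, z) by rewrite /supp /= inner_delta.
  by rewrite /diagonal /= => ->; rewrite negbK.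
by rewrite innerZr conjCK inner_delta.
Qed.

Lemma ell_infty_delta b x : ell_infty b -> b (delta R x) = b (delta R x) x *: delta R x.
Proof.
move=> db; apply: ell2_eqP => z;
  rewrite (ell_infty_apply _ _ db) ell2ZE !deltaE.
by case: eqVneq => [->//|]; rewrite !mulr0.
Qed.

End DiagonalOperators.

(** * Rank one and control by metric bands *)

Section CaseOfSurjectionOnDiagonal.
Variables (R : realType) (X Y : choiceType).
Variables (E : set (set (X * X))) (F : set (set (Y * Y))).
Variable Phi : operator R X -> operator R Y.
Hypotheses (cE : coarse_structure E) (uE : uniformly_locally_finite E).
Hypothesis Phi_emb : embedding (uniform_Roe E) (uniform_Roe F) Phi.

(** Each [chi y] is an image, so its compression by [Phi (chi x)] is scalar by [Phi_compress]. *)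
Lemma rank_one_of_range x :
  @ell_infty R Y `<=` Phi @` uniform_Roe E ->
  exists2 w : ell2 R Y, l2norm w = 1 & forall u, Phi (chi x) u = inner u w *: w.
Proof.
move=> onto; apply: (rank_one cE uE Phi_emb) => y.
have [q rq qE] : (Phi @` uniform_Roe E) (chi y).
  by apply: onto; rewrite chiE; exact: ell_infty_res.
by exists (q (delta R x) x) => u; rewrite -qE (Phi_compress cE uE Phi_emb).
Qed.

Variable xi : X -> ell2 R Y.
Hypothesis xi1 : forall x, l2norm (xi x) = 1.
Hypothesis PhiE : forall x u, Phi (chi x) u = inner u (xi x) *: xi x.

Lemma Phi_res_fset (s : {fset X}) u : Phi (res [set` s]) u = span_proj xi s u.
Proof.
rewrite /span_proj; move: (fset_uniq s).
have -> : [set` s] = [set` enum_fset s] by [].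
elim: (enum_fset s) => [_|x l IH /= /andP[xl ul]].
  rewrite big_nil (_ : res _ = 0) ?(Phi0 cE uE Phi_emb)//.
  by apply/funext => v; apply: ell2_eqP => z; rewrite resE mem_setE.
rewrite big_cons -IH// -PhiE.
have -> : @res R X [set` x :: l] = chi x + res [set` l].
  apply/funext => v; rewrite opDE chiE -resU.
    by congr (res _ v); apply/seteqP; split=> z /=; rewrite inE;
      [move=> /orP[/eqP|]; [left|right]|move=> [->|->]; rewrite ?eqxx ?orbT].
  by apply/seteqP; split=> // z [/= -> zl]; move: xl; rewrite zl.
by rewrite (Phi_D Phi_emb)//; [exact: (Roe_chi R cE)|exact: (Roe_res R cE)].
Qed.

Variable d : X -> X -> R.
Hypothesis d_metric : is_metric d.
Hypothesis dE : E = [set U | (ereal_sup [set (d p.1 p.2)%:E | p in U] < +oo)%E].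

Definition metric_band n : set (X * X) := [set p | d p.1 p.2 <= n%:R].

Lemma metric_band_mono m n : (m <= n)%N -> metric_band m `<=` metric_band n.
Proof. by move=> mn p; rewrite /metric_band /= => /le_trans; apply;
  rewrite ler_nat. Qed.

Lemma metric_band_refl n x : metric_band n (x, x).
Proof.
by have [_ d0 _ _] := d_metric; rewrite /metric_band /= (d0 x x).2.
Qed.

Lemma metric_band_sym n x z : metric_band n (x, z) -> metric_band n (z, x).
Proof. by have [_ _ ds _] := d_metric; rewrite /metric_band /= ds. Qed.

Lemma metric_band_entourage n : E (metric_band n).
Proof.
rewrite dE /=; apply: (@le_lt_trans _ _ (n%:R)%:E); last exact: ltry.
by apply: ge_ereal_sup => _ [p pn <-]; rewrite lee_fin.
Qed.

Lemma sub_metric_band U : E U -> exists n, U `<=` metric_band n.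
Proof.
rewrite dE /= => Uoo; set S := ereal_sup _ in Uoo.
have US p : U p -> ((d p.1 p.2)%:E <= S)%E.
  by move=> Up; apply: ereal_sup_ubound; exists p.
case: S US Uoo => [r| |] US // _.
  exists (Num.truncn r).+1 => p /US; rewrite lee_fin => /le_trans; apply.
  by apply/ltW; rewrite truncnS_gt.
(* A supremum equal to [-oo] leaves no pair in [U]. *)
by exists 0%N => p /US; rewrite leNgt ltNyr.
Qed.

Lemma metric_band_row n : exists N, forall x, exists2 s : {fset X},
  (#|` s| <= N)%N & forall w, w \in s = metric_band n (x, w) :> Prop.
Proof.
have [N NP] := uE (metric_band_entourage n).
by exists N => x; exact: (card_le_fsetP _ _).1 (NP x).
Qed.

Lemma metric_band_col n : exists N, forall x, exists2 s : {fset X},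
  (#|` s| <= N)%N & forall w, w \in s = metric_band n (w, x) :> Prop.
Proof.
have [N NP] := metric_band_row n; exists N => x; have [s sN sP] := NP x.
exists s => // w; rewrite sP; apply/propext.
by split; exact: metric_band_sym.
Qed.

(** [res A] is some [Phi q], and [q] is [eta]-close to some [b] of finite propagation n.
    [Phi b (xi x)] lies in the span of the [xi w] within distance n of x, hence is orthogonal to
    [v], and [l2norm_Phi_xi] bounds the rest. *)
Lemma metric_band_controls : @ell_infty R Y `<=` Phi @` uniform_Roe E ->
  forall A (eta : R), 0 < eta -> exists n, controlled xi metric_band n eta A.
Proof.
move=> onto A eta eta0.
have [q rq qE] := onto _ (@ell_infty_res R Y A).
have [bq /(_ _ eta0)[b [bb Eb] hb]] := rq.
have rb : uniform_Roe E b by apply: sub_uniform_Roe.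
have [n bn] := sub_metric_band Eb; exists n => x v out.
have -> : res A (xi x) = Phi (q - b) (xi x) + Phi b (xi x).
  by rewrite (Phi_B Phi_emb)// opDE opNE qE subrK.
have [N /(_ x)[s _ sP]] := metric_band_row n.
have -> : Phi b (xi x) = span_proj xi s (Phi b (xi x)).
  rewrite -Phi_res_fset -{1 2}(Phi_chi_xi xi1 PhiE x).
  have rx := Roe_chi R cE x; have rs := Roe_res R cE [set` s].
  have rbx := Roe_M cE uE rb rx.
  rewrite -(Phi_M Phi_emb _ rb rx) -(Phi_M Phi_emb _ rs rbx).
  congr (Phi _ (xi x)); apply/funext => u /=; rewrite chiE res1 (bopZ bb).
  apply: ell2_eqP => w; rewrite resE mem_setE; case: ifPn => // ws.
  rewrite ell2ZE; have [->|bw] := eqVneq (b (delta R x) w) 0;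
    first by rewrite mulr0.
  have /metric_band_sym xw : metric_band n (w, x).
    by apply: bn; rewrite /supp /= inner_delta.
  by move: ws; rewrite -(sP w) in xw *; rewrite xw.
rewrite innerDl inner_suml big_seq [X in _ + X]big1 ?addr0 => [|w ws];
  last first.
  rewrite innerZl (innerC v (xi w)) out ?conjC0 ?mulr0//.
  by rewrite -sP.
apply: le_trans (cauchy_schwarz _ _) _; rewrite ler_wpM2r ?l2norm_ge0//.
rewrite (l2norm_Phi_xi cE uE Phi_emb xi1 PhiE); last exact: (Roe_B cE uE).
apply: le_trans (l2norm_bop _ _) _; first exact: bounded_opB.
by rewrite l2norm_delta mulr1 ltW.
Qed.

End CaseOfSurjectionOnDiagonal.

(** * The image of the diagonal operators is a Cartan masa *)

Section Masa.
Variables (R : realType) (Y : choiceType).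
Implicit Types (A B S : set (operator R Y)).

Definition commutant S : set (operator R Y) :=
  [set t | bounded_op t /\ forall s, S s -> s \o t = t \o s].

Lemma star_subalgebra_commutant S : S `<=` @bounded_op R Y ->
  (forall s, S s -> S (adj s)) -> star_subalgebra (commutant S).
Proof.
move=> Sb Sadj; split.
- by move=> t [].
- split=> [|s Ss]; first exact: bounded_op0.
  by apply/funext => u /=; rewrite !op0E (bop0 (Sb _ Ss)).
- move=> c a b [ba aS] [bb bS]; split; first exact: bounded_opDZ.
  move=> s Ss; apply/funext => u /=.
  have /= asu := congr1 (fun f => f u) (aS _ Ss);
    have /= bsu := congr1 (fun f => f u) (bS _ Ss).
  by rewrite !opE (bop_lin (Sb _ Ss)) asu bsu.
- move=> a b [ba aS] [bb bS]; split; first exact: bounded_op_comp.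
  by move=> s Ss; rewrite compA (aS _ Ss) -compA (bS _ Ss).
- move=> a [ba aS]; split; first exact: bounded_op_adj.
  move=> s Ss; have bs := Sb _ Ss; have bs' := bounded_op_adj bs.
  by rewrite -{1}(adjK bs) -adj_comp// -(aS _ (Sadj _ Ss)) adj_comp// adjK.
Qed.

Lemma masa_mem A B h : star_subalgebra A -> masa A B -> A h -> adj h = h ->
  (forall b, B b -> b \o h = h \o b) -> B h.
Proof.
move=> [Ab A0 ADZ AM Aadj] [[[Bb _ _ _ Badj] BA Bcomm] Bmax] Ah hh hB.
pose S := B `|` [set h].
have Sb : S `<=` @bounded_op R Y by move=> s [/Bb//|->]; exact: Ab.
have Sadj s : S s -> S (adj s) by move=> [/Badj|->];
  [left|right; rewrite /= hh].
have Scomm : S `<=` commutant S.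
  move=> s Ss; split; first exact: Sb.
  move=> t St; move: Ss St => [Bs|->] [Bt|->//]; first exact: Bcomm.
  - by rewrite hB.
  - by rewrite hB.
have [C1b C10 C1DZ C1M C1adj] := star_subalgebra_commutant Sb Sadj.
have [C2b C20 C2DZ C2M C2adj] := star_subalgebra_commutant C1b C1adj.
have SC2 : S `<=` commutant (commutant S).
  by move=> s Ss; split; [exact: Sb|move=> t [_ ->]].
have := Bmax (A `&` commutant (commutant S)); apply; last 2 first.
- by move=> b Bb'; split; [exact: BA|apply: SC2; left].
- by split=> //; apply: SC2; right.
split; first split.
- by move=> a [/Ab].
- by [].
- by move=> c a b [? ?] [? ?]; split; [exact: ADZ|exact: C2DZ].
- by move=> a b [? ?] [? ?]; split; [exact: AM|exact: C2M].
- by move=> a [? ?]; split; [exact: Aadj|exact: C2adj].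
- by move=> a [].
- move=> a b [_ C2a] [_ C2b'].
  have C1a : commutant S a by split;
    [exact: C2b|move=> s /Scomm Cs; rewrite C2a.2].
  by rewrite C2b'.2.
Qed.

End Masa.

(** * Relations with uniformly finite rows and columns *)

Section RowFinite.
Variable X : choiceType.
Implicit Types U V : set (X * X).

Definition row_finite U := exists n : nat, forall x, [set z | U (x, z)] #<= `I_n.

Lemma row_finite_sub U V : U `<=` V -> row_finite V -> row_finite U.
Proof.
move=> UV [n Vn]; exists n => x; apply: card_le_trans (Vn x).
by apply: subset_card_le => z; exact: UV.
Qed.

Lemma row_finiteU U V : row_finite U -> row_finite V -> row_finite (U `|` V).
Proof.
move=> [m Um] [n Vn]; exists (m + n)%N => x.
have [s sm sU] := (card_le_fsetP _ _).1 (Um x).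
have [t tn tV] := (card_le_fsetP _ _).1 (Vn x).
apply/card_le_fsetP; exists (s `|` t)%fset.
  by apply: leq_trans (cardfsU_le _ _) _; exact: leq_add.
move=> w; rewrite inE; apply/propext; split=> [/orP[]|[]].
- by rewrite sU => ?; left.
- by rewrite tV => ?; right.
- by move=> Uw; apply/orP; left; rewrite sU.
- by move=> Vw; apply/orP; right; rewrite tV.
Qed.

Lemma row_finite_comp U V : row_finite U -> row_finite V -> row_finite (V \; U)%relation.
Proof.
move=> [m Um] [n Vn]; exists (m * n)%N => x; apply: card_le_bounded => s sUV.
have [t tm tU] := (card_le_fsetP _ _).1 (Um x).
have /choice[r rP] : forall z, exists r : {fset X},
    (#|` r| <= n)%N /\ forall w, w \in r = V (z, w) :> Prop.
  by move=> z; have [r ? ?] := (card_le_fsetP _ _).1 (Vn z); exists r.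
have [q qM qP] := fset_bigcup_le (enum_fset t) (fun z => (rP z).1).
apply: leq_trans (fsubset_leq_card _) (leq_trans qM _);
  last by rewrite leq_mul2r tm orbT.
apply/fsubsetP => w /sUV[/= z Uz Vz].
by apply: (fsubsetP (qP z _)); rewrite ?(rP z).2 ?tU.
Qed.

Definition bi_row_finite : set (set (X * X)) :=
  [set U | row_finite U /\ row_finite (U^-1)%relation].

Lemma coarse_bi_row_finite : coarse_structure bi_row_finite.
Proof.
have diag : row_finite (@diagonal X).
  exists 1%N => x; apply/card_le_fsetP; exists [fset x]%fset;
    first by rewrite cardfs1.
  by move=> w; rewrite inE /diagonal /=; apply/propext; split=> [/eqP->|->].
split.
- by split=> //; apply: row_finite_sub diag => -[x z] /=; rewrite /diagonal /=.
- move=> U V UV [Vr Vc]; split; first exact: row_finite_sub Vr.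
  by apply: row_finite_sub Vc => p; exact: UV.
- by move=> U V [Ur Uc] [Vr Vc]; split; apply: row_finiteU.
- by move=> U [Ur Uc]; split=> //; apply: row_finite_sub Ur => -[].
- move=> U V [Ur Uc] [Vr Vc]; split; first exact: row_finite_comp.
  by apply: row_finite_sub (row_finite_comp Vc Uc) => -[x z] [/= w ? ?];
    exists w.
Qed.

Lemma ulf_bi_row_finite : uniformly_locally_finite bi_row_finite.
Proof. by move=> U []. Qed.

(* The coarse structure generated by a sequence of relations has a countable
   base. *)
Lemma countably_generated (G : nat -> set (X * X)) :
  (forall n, bi_row_finite (G n)) -> exists T : nat -> set (X * X),
  [/\ forall m n, (m <= n)%N -> T m `<=` T n,
      forall n x, T n (x, x),
      forall n, bi_row_finite (T n),
      forall n, G n `<=` T n.+1 &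
      coarse_structure [set U | exists n, U `<=` T n] /\
      forall n, ((T n)^-1)%relation `<=` T n.+1].
Proof.
move=> Gfin; have [Kd Ksub KU Kinv Kcomp] := coarse_bi_row_finite.
(* Each stage adds the next generator, symmetrizes and adjoins composites, so inverses and
   composites of one stage appear in the next. *)
pose step (U V : set (X * X)) := let W := (U `|` V) `|` ((U `|` V)^-1)%relation in
  W `|` (W \; W)%relation.
pose T := fix T n := if n is m.+1 then step (T m) (G m) else @diagonal X.
have TS n : T n `<=` T n.+1 by move=> p Tp; left; left; left.
have Tmono m n : (m <= n)%N -> T m `<=` T n.
  by move=> /subnK <-; elim: (n - m)%N => // k IH p /IH; exact: TS.
have Trefl n x : T n (x, x) by apply: (Tmono 0%N).
have Tfin n : bi_row_finite (T n).
  elim: n => [|n IH]; first exact: Kd.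
  have KV : bi_row_finite (T n `|` G n) by exact: KU.
  have KW : bi_row_finite ((T n `|` G n) `|` ((T n `|` G n)^-1)%relation).
    by apply: KU => //; exact: Kinv.
  by apply: KU => //; exact: Kcomp.
have Tinv n : ((T n)^-1)%relation `<=` T n.+1.
  by move=> -[x z] /= Tzx; left; right; left.
exists T; split=> //; first by move=> n p Gp; left; left; right.
split=> //; split.
- by exists 0%N.
- by move=> U V UV [n Vn]; exists n; exact: subset_trans Vn.
- move=> U V [m Um] [n Vn]; exists (maxn m n) => p [/Um|/Vn]; apply: Tmono.
    exact: leq_maxl.
  exact: leq_maxr.
- move=> U [n Un]; exists n.+1 => p Up; apply: (Tinv n); exact: Un Up.
- move=> U V [m Um] [n Vn]; exists (maxn m n).+1 => -[x z] [/= w Uw Vw].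
  right; exists w => /=; left; left.
    by apply: Tmono (Um _ Uw); exact: leq_maxl.
  by apply: Tmono (Vn _ Vw); exact: leq_maxr.
Qed.

End RowFinite.

(** * Rank one, totality and normalizers for a Cartan masa *)

Section CartanCase.
Variables (R : realType) (X Y : choiceType).
Variables (E : set (set (X * X))) (F : set (set (Y * Y))).
Variable Phi : operator R X -> operator R Y.
Hypotheses (cE : coarse_structure E) (uE : uniformly_locally_finite E).
Hypotheses (cF : coarse_structure F) (uF : uniformly_locally_finite F).
Hypothesis Phi_emb : embedding (uniform_Roe E) (uniform_Roe F) Phi.
Local Notation A := (@uniform_Roe R Y F).
Local Notation B := (Phi @` @ell_infty R X).

Let Roe_diag (b : operator R X) : ell_infty b -> uniform_Roe E b.
Proof. exact: ell_infty_uniform_Roe. Qed.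

Lemma Phi_diag_chi (b : operator R X) x u : ell_infty b ->
  Phi b (Phi (chi x) u) = b (delta R x) x *: Phi (chi x) u.
Proof.
move=> db; have rb := Roe_diag db; have rx := Roe_chi R cE x.
rewrite -(Phi_M Phi_emb _ rb rx) -opZE -(Phi_Z cE uE Phi_emb)//.
congr (Phi _ u); apply/funext => v /=.
by rewrite opZE chiE res1 (bopZ db.1) {1}(ell_infty_delta x db) !scalerA mulrC.
Qed.

Lemma Phi_chi_diag (b : operator R X) x u : ell_infty b ->
  Phi (chi x) (Phi b u) = b (delta R x) x *: Phi (chi x) u.
Proof.
move=> db; have rb := Roe_diag db; have rx := Roe_chi R cE x.
rewrite -(Phi_M Phi_emb _ rx rb) -opZE -(Phi_Z cE uE Phi_emb)//.
congr (Phi _ u); apply/funext => v /=.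
by rewrite opZE chiE !res1 (ell_infty_apply _ _ db) scalerA.
Qed.

(** With p = Phi(chi_x), both p Phi(b) and Phi(b) p are b_xx p for diagonal b. So p chi_y p commutes
    with the masa, lies in it, and equals some Phi(q); multiplying by p once more makes it q_xx
    p. *)
Lemma rank_one_of_masa x : masa A B ->
  exists2 w : ell2 R Y, l2norm w = 1 & forall u, Phi (chi x) u = inner u w *: w.
Proof.
move=> AB; apply: (rank_one cE uE Phi_emb) => y.
pose p := Phi (chi x); have rx := Roe_chi R cE x.
have pp u : p (p u) = p u by rewrite /p chiE (Phi_res_idem cE Phi_emb).
have bp : bounded_op p by apply: (Phi_bounded Phi_emb).
have adjp : adj p = p.
  by apply: adj_unique => // u v; rewrite /p chiE (Phi_res_inner cE Phi_emb).
have bchi := @bounded_op_chi R Y y.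
pose h := (p \o chi y) \o p.
have Ah : A h.
  have Ap := Phi_Roe Phi_emb rx; have Ay := Roe_chi R cF y.
  exact: (Roe_M cF uF (Roe_M cF uF Ap Ay) Ap).
have hh : adj h = h.
  have adjy : adj (@chi R Y y) = chi y by rewrite chiE adj_res.
  by rewrite /h (adj_comp (bounded_op_comp bp bchi) bp) (adj_comp bp bchi) adjp adjy.
have [q dq qh] : B h.
  apply: (masa_mem (cstar_uniform_Roe R cF uF).1 AB Ah hh).
  move=> _ [b db <-]; apply/funext => u; rewrite /h /=.
  have pb : p (Phi b u) = b (delta R x) x *: p u by exact: Phi_chi_diag.
  have bpu t : Phi b (p t) = b (delta R x) x *: p t by exact: Phi_diag_chi.
  by rewrite bpu pb (bopZ bchi) (bopZ bp).
exists (q (delta R x) x) => u.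
have := Phi_diag_chi x u dq; rewrite qh /h /= -/p => <-.
by rewrite pp.
Qed.

Variable xi : X -> ell2 R Y.
Hypothesis xi1 : forall x, l2norm (xi x) = 1.
Hypothesis PhiE : forall x u, Phi (chi x) u = inner u (xi x) *: xi x.

Let xi_on := xi_orthonormal cE uE Phi_emb xi1 PhiE.

Lemma Phi_diag_xi (b : operator R X) x : ell_infty b -> Phi b (xi x) = b (delta R x) x *: xi x.
Proof.
by move=> db;
  rewrite -{1}(Phi_chi_xi xi1 PhiE x) Phi_diag_chi// (Phi_chi_xi xi1 PhiE).
Qed.

(** The rank-one operator of [u], namely |u|^2 times the projection onto its line. *)
Definition theta (u : ell2 R Y) : operator R Y := fun v => inner v u *: u.

Lemma bounded_op_theta u : bounded_op (theta u).
Proof.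
apply: (@bounded_op_opnorm _ _ _ (l2norm u * l2norm u)) => [k v w|v].
  by rewrite /theta innerDl innerZl scalerDl scalerA.
by rewrite l2normZ [leLHS]mulrC -mulrA ler_wpM2l ?l2norm_ge0// [leRHS]mulrC cauchy_schwarz.
Qed.

Lemma adj_theta u : adj (theta u) = theta u.
Proof.
apply: adj_unique; first exact: bounded_op_theta.
by move=> v w; rewrite /theta innerZl innerZr -innerC mulrC.
Qed.

(** Truncating [u] to a finite set C gives an operator supported in C x C, which is bounded for the
    metric. *)
Lemma theta_uniform_Roe u : metrizable R F -> A (theta u).
Proof.
move=> [d dm dF]; split; first exact: bounded_op_theta.
(* Truncation changes [theta u] by at most 2 |u| times the norm of the tail; the added 1 makes [K]
   positive. *)
move=> e e0; pose K := 2 * l2norm u + 1.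
have K0 : 0 < K by rewrite ltr_wpDl// mulr_ge0// l2norm_ge0.
have [C CP] := res_approx u (divr_gt0 (divr_gt0 e0 (ltr0n _ 2)) K0).
have ru : u - res [set` C] u = res (~` [set` C]) u by rewrite resC.
exists (theta (res [set` C] u)).
  split; first exact: bounded_op_theta.
  have CE a b : a \in C -> b \in C -> d a b <= \sum_(a <- C) \sum_(b <- C) d a b.
    have [d0 _ _ _] := dm; move=> aC bC;
      rewrite (big_fsetD1 a)//= (big_fsetD1 b)//=.
    rewrite -addrA lerDl addr_ge0// sumr_ge0// => z _.
    by rewrite sumr_ge0.
  rewrite dF /=;
    apply: (@le_lt_trans _ _ (\sum_(a <- C) \sum_(b <- C) d a b)%:E);
      last exact: ltry.
  apply: ge_ereal_sup => _ [[a b] ab <-]; rewrite lee_fin /=; move: ab.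
  rewrite /supp /= inner_delta /theta ell2ZE delta_inner !resE !mem_setE.
  case: ifPn => [bC|_]; last by rewrite conjC0 mul0r eqxx.
  by case: ifPn => [aC _|_]; [exact: CE|rewrite mulr0 eqxx].
apply: (@le_lt_trans _ _ (e / 2));
  last by rewrite ltr_pdivrMr// mulr_natr mulr2n ltrDl.
apply: opnorm_le => [|v]; first by rewrite divr_ge0 ?(ltW e0).
rewrite !opE /theta.
have -> : inner v u *: u - inner v (res [set` C] u) *: res [set` C] u =
    inner v (res (~` [set` C]) u) *: u + inner v (res [set` C] u) *: res (~` [set` C]) u.
  by rewrite -ru innerBr scalerBl scalerBr addrA subrK.
apply: le_trans (l2normD _ _) _; rewrite !l2normZ.
set r := l2norm (res (~` [set` C]) u) in CP *.
have r0 : 0 <= r by exact: l2norm_ge0.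
have h1 := cauchy_schwarz v (res (~` [set` C]) u); rewrite -/r in h1.
have h2 := cauchy_schwarz v (res [set` C] u).
have h3 := l2norm_res [set` C] u.
have u0 := l2norm_ge0 u; have v0 := l2norm_ge0 v.
have h4 : absC (inner v (res [set` C] u)) <= l2norm v * l2norm u.
  by apply: le_trans h2 _; rewrite ler_wpM2l.
apply: (@le_trans _ _ (l2norm v * r * l2norm u + l2norm v * l2norm u * r)).
  by rewrite lerD// ler_wpM2r.
have -> : l2norm v * r * l2norm u + l2norm v * l2norm u * r = (r * (2 * l2norm u)) * l2norm v by ring.
rewrite ler_wpM2r//; move: CP; rewrite ltr_pdivlMr// /K => /ltW;
  apply: le_trans.
by rewrite ler_wpM2l// lerDl.
Qed.

(** If u is orthogonal to every [xi x], all compressions of [theta u] by the [Phi (chi x)] vanish.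
    Then its conditional expectation has zero diagonal, hence is 0, and faithfulness gives
    [theta u = 0]. *)
Lemma xi_total : metrizable R F -> 
  (exists Ups, faithful_conditional_expectation A B Ups) ->
  forall u, (forall x, inner u (xi x) = 0) -> u = 0.
Proof.
move=> mF [Ups [[UB Ulin _] _ Ubimod Ufaith]] u u0.
have Atheta := theta_uniform_Roe u mF; have [A0 ADZ] : A 0 /\
   forall (c : R[i]) a b, A a -> A b -> A (c *: a + b).
  by split; [exact: Roe0|exact: Roe_DZ].
have U0 : Ups 0 = 0.
  have := Ulin 1 0 0 A0 A0; rewrite !scale1r addr0 => /eqP.
  by rewrite -subr_eq subrr eq_sym => /eqP.
have [b db bU] := UB _ Atheta.
have b0 x : b (delta R x) x = 0.
  have Bx : B (Phi (chi x)) by exists (chi x) => //; rewrite chiE;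
    exact: ell_infty_res.
  have := Ubimod _ _ _ Atheta Bx Bx.
  have -> : (Phi (chi x) \o theta u) \o Phi (chi x) = 0.
    by apply/funext => v /=; rewrite PhiE /theta innerZl u0 mulr0 scale0r.
  rewrite U0 -bU => /(congr1 (fun f => f (xi x))).
  rewrite op0E /= (Phi_chi_xi xi1 PhiE) Phi_diag_xi// PhiE innerZl xi_on eqxx mulr1.
  move=> /(congr1 (@l2norm _ _)); rewrite l2norm0 l2normZ xi1 mulr1 => /eqP.
  by rewrite eq_sym absC_eq0 => /eqP.
have bE0 : b = 0.
  apply/funext => v; apply: ell2_eqP => x.
  by rewrite (ell_infty_apply _ _ db) b0 mul0r.
have Uth : Ups (theta u) = 0 by rewrite -bU bE0 (Phi0 cE uE Phi_emb).
have th0 : theta u = 0.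
  apply: Ufaith => //; rewrite adj_theta.
  (* The summand 0 brings the product into the form c a + b required by [Ulin]. *)
  have -> : theta u \o theta u = (inner u u) *: theta u + 0.
    by apply/funext => v;
      rewrite opDE op0E opZE /= /theta innerZl addr0 scalerA mulrC.
  by rewrite Ulin// Uth U0 scaler0 addr0.
have := congr1 (fun f => f u) th0; rewrite op0E /theta inner_self.
move=> /(congr1 (@l2norm _ _)); rewrite l2norm0 l2normZ absC_real => /eqP.
rewrite mulf_eq0 normr_eq0 sqrf_eq0 orbb => /eqP; exact: l2norm_eq0.
Qed.

Lemma normalizer_adj n : normalizer A B n -> normalizer A B (adj n).
Proof.
move=> [An nB]; split; first exact: Roe_adj.
have bn : bounded_op n by exact: Roe_bounded An.
by move=> b /nB[? ?]; rewrite (adjK bn).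
Qed.

(** The operator n Phi(chi_z) adj(n) lies in the masa, hence is diagonal in the basis [xi]; its
    off-diagonal entries are products of two entries in column z of n. *)
Lemma normalizer_injective n x x' z : normalizer A B n ->
  matrix_supp xi n (x, z) -> matrix_supp xi n (x', z) -> x = x'.
Proof.
move=> [An nB]; rewrite /matrix_supp /= => nx nx'; apply/eqP;
  apply: contraT => xx'.
have bn : bounded_op n by exact: Roe_bounded An.
have Bz : B (Phi (chi z)) by exists (chi z) => //; rewrite chiE;
  exact: ell_infty_res.
have [[b db bE] _] := nB _ Bz.
have := congr1 (fun f => inner (f (xi x')) (xi x)) bE.
rewrite Phi_diag_xi// innerZl xi_on eq_sym (negPf xx') mulr0 /= PhiE (bopZ bn) innerZl.
rewrite inner_adjr// => /esym/eqP; rewrite mulf_eq0 (negPf nx) orbF.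
by rewrite (innerC (n (xi z))) conjC_eq0 (negPf nx').
Qed.

Lemma injective_row_finite (U : set (X * X)) :
  (forall x z z', U (x, z) -> U (x, z') -> z = z') -> row_finite U.
Proof.
move=> Uinj; exists 1%N => x; apply: card_le_bounded => s sU.
have [->|[z zs]] := fset_0Vmem s; first by rewrite cardfs0.
rewrite (cardfsD1 z) zs add1n ltnS leqn0 cardfs_eq0; apply/eqP/fsetP => w.
rewrite !inE; apply/negbTE; rewrite negb_and negbK.
have [ws|] := boolP (w \in s); last by rewrite orbT.
by rewrite (Uinj x w z) ?eqxx//; exact: sU.
Qed.

Lemma normalizer_band n : normalizer A B n -> band xi (@bi_row_finite X) n.
Proof.
move=> Nn; have bn : bounded_op n by exact: Roe_bounded Nn.1.
split=> //; split; apply: injective_row_finite => x z z' /=.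
  have adjE w : matrix_supp xi n (x, w) -> matrix_supp xi (adj n) (w, x).
    by rewrite /matrix_supp /= inner_adjr// innerC conjC_eq0.
  by move=> /adjE h /adjE; exact: normalizer_injective (normalizer_adj Nn) h.
by move=> h h'; exact: normalizer_injective Nn h h'.
Qed.

End CartanCase.

(** * Controlling relations from co-separability *)

Section CartanControls.
Variables (R : realType) (X Y : choiceType).
Variables (E : set (set (X * X))) (F : set (set (Y * Y))).
Variable Phi : operator R X -> operator R Y.
Hypotheses (cE : coarse_structure E) (uE : uniformly_locally_finite E).
Hypotheses (cF : coarse_structure F) (uF : uniformly_locally_finite F).
Hypothesis Phi_emb : embedding (uniform_Roe E) (uniform_Roe F) Phi.
Variable xi : X -> ell2 R Y.
Hypothesis xi1 : forall x, l2norm (xi x) = 1.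
Hypothesis PhiE : forall x u, Phi (chi x) u = inner u (xi x) *: xi x.
Hypothesis xi_tot : forall u, (forall x, inner u (xi x) = 0) -> u = 0.
Local Notation A := (@uniform_Roe R Y F).
Local Notation B := (Phi @` @ell_infty R X).

Let xi_on := xi_orthonormal cE uE Phi_emb xi1 PhiE.

(** The right-hand side is a C-star algebra containing the normalizer, so it contains the algebra
    generated by it. *)
Lemma sub_closure_band :
  A = cstar_generated (normalizer A B) -> A `<=` norm_closure (band xi (@bi_row_finite X)).
Proof.
move=> AN a Aa; have := Aa;
  rewrite AN => /(_ (norm_closure (band xi (@bi_row_finite X)))).
apply; split.
  apply/cstar_norm_closure/star_subalgebra_band => //.
  - exact: coarse_bi_row_finite.
  - exact: ulf_bi_row_finite.
move=> n Nn; apply: sub_norm_closure; first by move=> b [].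
by apply: (normalizer_band cE uE cF uF Phi_emb xi1 PhiE).
Qed.

Lemma cartan_controls :
  A = cstar_generated (normalizer A B) -> co_separable A B ->
  exists T : nat -> set (X * X),
  [/\ forall m n, (m <= n)%N -> T m `<=` T n,
      forall n x, T n (x, x),
      forall n, bi_row_finite (T n) &
      forall C (eta : R), 0 < eta -> exists n, controlled xi T n eta C].
Proof.
move=> AN [S [/countable_injP[g ginj] SA AS]].
have /choice[t tP] : forall sk : operator R Y * nat, exists b,
    S sk.1 -> band xi (@bi_row_finite X) b /\ opnorm (sk.1 - b) < sk.2.+1%:R^-1.
  (* Outside [S] the value 0 is only a default. *)
  move=> [s k]; have [Ss|nS] := pselect (S s); last by exists 0.
  have [_ /(_ k.+1%:R^-1)] := sub_closure_band AN (SA _ Ss).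
  by rewrite invr_gt0 => /(_ (ltr0Sn _ _))[b bb hb]; exists b.
pose code (m k : nat) : nat := choice.pickle (m, k).
(* [G m] is the matrix support of the approximant with code [m], and is empty when [m] codes no
   pair. *)
pose G (m : nat) := [set p | exists s k, [/\ S s, m = code (g s) k & matrix_supp xi (t (s, k)) p]].
have GE s k : S s -> G (code (g s) k) = matrix_supp xi (t (s, k)).
  move=> Ss; apply/seteqP; split=> [p [s' [k' [Ss' e]]]|p]; last by exists s, k.
  have [gs ->] := pcan_inj choice.pickleK e.
  by rewrite (ginj s' s)// in_setE.
have Gfin m : bi_row_finite (G m).
  have [[s [k [Ss ->]]]|nos] := pselect (exists s k, S s /\ m = code (g s) k).
    by rewrite GE//; have [[]] := tP (s, k) Ss.
  have [Kd Ksub _ _ _] := @coarse_bi_row_finite X.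
  by apply: Ksub Kd => p [s [k [Ss e _]]]; case: nos; exists s, k.
have [T [Tmono Trefl Tfin GT [cT Tinv]]] := countably_generated Gfin.
exists T; split=> // C eta eta0.
pose K := [set U | exists n, U `<=` T n].
have uK : uniformly_locally_finite K.
  by move=> U [n Un]; apply: row_finite_sub Un _; have [] := Tfin n.
(* The generators suffice: images of diagonal operators are diagonal in the basis [xi], and members
   of [S] are limits of the chosen approximants. *)
have Ksub : A `<=` norm_closure (band xi K).
  move=> a; rewrite AS => /(_ (norm_closure (band xi K))); apply; split.
    exact/cstar_norm_closure/star_subalgebra_band.
  move=> b [[q dq <-]|Sb].
    apply: sub_norm_closure; first by move=> c [].
    split; first exact/(Phi_bounded Phi_emb)/ell_infty_uniform_Roe.
    exists 0%N => -[x z]; rewrite /matrix_supp /=.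
    rewrite (Phi_diag_xi cE uE Phi_emb xi1 PhiE)// innerZl xi_on.
    by have [->|] := eqVneq z x; rewrite ?mulr0 ?eqxx.
  split; first by case: (SA _ Sb).
  move=> e e0; have [k ke] : exists k : nat, k.+1%:R^-1 < e.
    exists (Num.truncn e^-1); rewrite invf_plt ?posrE//.
    exact: truncnS_gt.
  have [[bt tfin] tb] := tP (b, k) Sb.
  exists (t (b, k)); last exact: lt_trans tb ke.
  by split=> //; exists (code (g b) k).+1; rewrite -GE.
have Ares : A (@res R Y C) by exact: Roe_res.
have [_ /(_ _ eta0)[b [bb [n bn]] hb]] := Ksub _ Ares.
(* The matrix support of [b] has pairs (w, x) while [outside] reads (x, w); the inversion costs one
   level. *)
exists n.+1 => x v out.
have [N /(_ x)/card_le_fsetP[s _ sP]] := (Tfin n.+1).1.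
have bE : b (xi x) = span_proj xi s (b (xi x)).
  apply: (span_proj_total xi_on xi_tot) => w bw; rewrite sP /=.
  by apply: Tinv; apply: bn.
have b0 : inner (b (xi x)) v = 0.
  rewrite bE inner_suml big_seq big1// => w ws.
  by rewrite innerZl (innerC v (xi w)) out ?conjC0 ?mulr0//; rewrite sP in ws.
have -> : inner (res C (xi x)) v = inner ((res C - b) (xi x)) v.
  by rewrite opDE opNE innerDl innerNl b0 subr0.
apply: le_trans (cauchy_schwarz _ _) _; rewrite ler_wpM2r ?l2norm_ge0//.
apply: le_trans (l2norm_bop _ _) _; first exact/bounded_opB/bb/bounded_op_res.
by rewrite (l2norm_xi xi_on) mulr1 ltW.
Qed.

End CartanControls.

(** * Assembly of the two conditions *)

Theorem theorem5p3 (R : realType) (X Y : choiceType)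
    (E : set (set (X * X))) (F : set (set (Y * Y)))
    (Phi : operator R X -> operator R Y) :
  coarse_structure E -> coarse_structure F ->
  uniformly_locally_finite E -> uniformly_locally_finite F ->
  metrizable R E ->
  embedding (uniform_Roe E) (uniform_Roe F) Phi ->
  (metrizable R F /\
   cartan_masa (uniform_Roe F) (Phi @` @ell_infty R X) /\
   co_separable (uniform_Roe F) (Phi @` @ell_infty R X)) \/
  @ell_infty R Y `<=` Phi @` uniform_Roe E ->
  exists f : X -> Y,
    [/\ coarse_map E F f,
        uniformly_finite_to_one f
      & (0 < ereal_inf
               [set (l2norm (Phi (chi x) (delta R (f x))))%:E | x in setT])%E].
Proof.
move=> cE cF uE uF [d dm dE] Phi_emb [[mF [[_ AB AN CE] cosep]]|onto].
  (* Under (1), maximality of the masa gives the range vectors and co-separability the relations. *)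
  have /choice[xi xiP] : forall x, exists w : ell2 R Y, l2norm w = 1 /\
      forall u, Phi (chi x) u = inner u w *: w.
    move=> x.
    by have [w w1 wP] := rank_one_of_masa cE uE cF uF Phi_emb x AB; exists w.
  have xi1 x := (xiP x).1; have PhiE x := (xiP x).2.
  have tot := xi_total cE uE cF uF Phi_emb xi1 PhiE mF CE.
  have [T [Tmono Trefl Tfin Tc]] := cartan_controls cE uE cF uF Phi_emb xi1 PhiE tot AN cosep.
  apply: (embedding_map cE uE Phi_emb xi1 PhiE Tmono Trefl Tc _ _ cF) => n.
    by have [[N NP] _] := Tfin n; exists N => x;
      exact: (card_le_fsetP _ _).1 (NP x).
  by have [_ [N NP]] := Tfin n; exists N => x;
    exact: (card_le_fsetP _ _).1 (NP x).
(* Under (2), the relations are the metric bands of X. *)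
have /choice[xi xiP] : forall x, exists w : ell2 R Y, l2norm w = 1 /\
    forall u, Phi (chi x) u = inner u w *: w.
  move=> x.
  by have [w w1 wP] := rank_one_of_range cE uE Phi_emb x onto; exists w.
have xi1 x := (xiP x).1; have PhiE x := (xiP x).2.
apply: (embedding_map (T := metric_band d) cE uE Phi_emb xi1 PhiE _ _ _ _ _ cF).
- exact: metric_band_mono.
- exact: (metric_band_refl dm).
- exact: (metric_band_controls cE uE Phi_emb xi1 PhiE dm dE onto).
- exact: (metric_band_row uE dE).
- exact: (metric_band_col uE dm dE).
Qed.
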